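(* Let $\delta\in(0,\overline\delta)$, $\kappa\in\mathbb{A}_\delta$ and $f\in L^q(\Omega)$. The (Lagrangian) dual problem $$\sup_{u\in L^p(\Omega)}\ \inf_{\sigma\in\mathbb{Q}_\delta}\Big[\hat I_\delta(\kappa;\sigma)+\int_\Omega [f(x)-\mathcal{D}_\delta\sigma(x)]u(x)\,dx\Big]$$ of the problem $\hat\imath_\delta(\kappa)=\inf_{\sigma\in\mathbb{Q}_\delta(f)}\hat I_\delta(\kappa;\sigma)$ is equivalent to the problem $\check\imath_\delta(\kappa)=\inf_{u\in\mathbb{U}_{\delta,0}}\check I_\delta(\kappa;u)$ (namely, it coincides with $\sup_{u\in\mathbb{U}_{\delta,0}}[-\check I_\delta(\kappa;u)]$). The dual problem admits a unique solution $u^*\in\mathbb{U}_{\delta,0}$. Strong duality holds, that is, $$\check\imath_\delta(\kappa)+\hat\imath_\delta(\kappa)=0.$$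
   Context: Fix an integer $n\ge 2$, exponents $1<p<\infty$ and $q$ with $1/p+1/q=1$, and a connected bounded open Lipschitz domain $\Omega\subset\mathbb{R}^n$. Kernels. For $\delta>0$ let $\Omega_\delta=\bigcup_{x\in\Omega}B(x,\delta)$, and let $\omega_\delta:\mathbb{R}^n\to[0,\infty)$ be a radial kernel supported in $B(0,\delta)$ with $\int_{\mathbb{R}^n}|x|^p\omega_\delta^p(x)\,dx=K_{p,n}^{-1}$, where $K_{p,n}=|\mathbb{S}^{n-1}|^{-1}\int_{\mathbb{S}^{n-1}}|e\cdot s|^p\,ds$ ($e\in\mathbb{S}^{n-1}$ arbitrary). Nonlocal gradient. Functions are extended by zero outside their explicit domain of definition. For $u\in L^p(\Omega)$ put $\mathcal{G}_\delta u(x,x')=[u(x)-u(x')]\omega_\delta(x-x')$, and $\mathbb{U}_{\delta,0}=\{u\in L^p(\Omega):\mathcal{G}_\delta u\in L^p(\Omega_\delta\times\Omega_\delta)\}$, which is dense in $L^p(\Omega)$. There are constants $\overline{\delta}>0$, $C>0$ with $\|u\|_{L^p(\Omega)}\le C\|\mathcal{G}_\delta u\|_{L^p(\Omega_\delta\times\Omega_\delta)}$ for all $u\in\mathbb{U}_{\delta,0}$, $\delta\in(0,\overline\delta)$ (known nonlocal Poincaré inequality). Nonlocal divergence. $\mathcal{D}_\delta:\mathbb{Q}_\delta=D(\mathcal{D}_\delta)\subset L^q(\Omega_\delta\times\Omega_\delta)\to L^q(\Omega)$ is the negative adjoint of $\mathcal{G}_\delta$: $\sigma\in\mathbb{Q}_\delta$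 iff there is $g=:\mathcal{D}_\delta\sigma\in L^q(\Omega)$ with $\int_\Omega g u\,dx=-\int_{\Omega_\delta}\int_{\Omega_\delta}\sigma\,\mathcal{G}_\delta u\,dx\,dx'$ for all $u\in\mathbb{U}_{\delta,0}$. Put $\mathbb{Q}_\delta(f)=\{\sigma\in\mathbb{Q}_\delta:\mathcal{D}_\delta\sigma=f\}$. Conductivities. $\mathbb{A}_\delta\subset L^\infty(\Omega_\delta\times\Omega_\delta)$ is a nonempty, convex, weakly$^*$ compact set such that every $\kappa\in\mathbb{A}_\delta$ satisfies $\underline\kappa\le\kappa(x,x')\le\overline\kappa$ and $\kappa(x,x')=\kappa(x',x)$ for a.e. $(x,x')$, with fixed constants $0<\underline\kappa\le\overline\kappa<\infty$. Energies. $\hat I_\delta(\kappa;\sigma)=\frac1q\int_{\Omega_\delta}\int_{\Omega_\delta}\kappa^{1-q}(x,x')|\sigma(x,x')|^q\,dx\,dx'$ and $\check I_\delta(\kappa;u)=\frac1p\int_{\Omega_\delta}\int_{\Omega_\delta}\kappa(x,x')|\mathcal{G}_\delta u(x,x')|^p\,dx\,dx'-\int_\Omega f(x)u(x)\,dx$. *)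

(* Defs.v *)
From HB Require Import structures.
From mathcomp Require Import all_boot all_order all_algebra.
From mathcomp Require Import all_classical all_reals all_analysis.
From mathcomp Require Import measurable_realfun ess_sup_inf hoelder.

Set Implicit Arguments.
Unset Strict Implicit.
Unset Printing Implicit Defensive.
Import Order.TTheory GRing.Theory Num.Theory.
Import numFieldNormedType.Exports.

Local Open Scope classical_set_scope.
Local Open Scope ring_scope.

(* R^n carries the sigma-algebra generated by its coordinates, which is the
   Borel sigma-algebra. *)
Definition rV_display : measure_display.
Proof. exact: default_measure_display. Qed.

Section measurable_rV.
Context {R : realType} {n : nat}.

Definition rV_coord (i : 'I_n) (x : 'rV[R]_n) : R := x ord0 i.

Let rV_set0 : g_sigma_preimage rV_coord set0.
Proof. exact: sigma_algebra0. Qed.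

Let rV_setC A : g_sigma_preimage rV_coord A ->
  g_sigma_preimage rV_coord (~` A).
Proof. exact: sigma_algebraC. Qed.

Let rV_bigcup (F : (set 'rV[R]_n)^nat) :
  (forall i, g_sigma_preimage rV_coord (F i)) ->
  g_sigma_preimage rV_coord (\bigcup_i (F i)).
Proof. exact: sigma_algebra_bigcup. Qed.

HB.instance Definition _ := @isMeasurable.Build rV_display
  'rV[R]_n (g_sigma_preimage rV_coord) rV_set0 rV_setC rV_bigcup.

Lemma measurable_rV_coord (i : 'I_n) :
  measurable_fun [set: 'rV[R]_n] (fun x : 'rV[R]_n => x ord0 i).
Proof.
move=> _ Y mY; rewrite setTI; apply: sub_sigma_algebra => /=.
rewrite -bigcup_seq/=; exists i => /=; first by rewrite mem_index_enum.
by exists Y => //; rewrite setTI.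
Qed.

Lemma measurable_fun_rVP d (T : measurableType d) (f : T -> 'rV[R]_n) :
  (forall i, measurable_fun [set: T] (fun t => f t ord0 i)) ->
  measurable_fun [set: T] f.
Proof.
move=> mf; have sf : g_sigma_preimage (fun i => rV_coord i \o f) `<=` measurable.
  apply: smallest_sub; first exact: sigma_algebra_measurable.
  rewrite -bigcup_seq; apply: bigcup_sub => i _ A [B mB <-].
  exact: mf.
move=> _ A mA; apply: sf; rewrite g_sigma_preimage_comp.
by exists A.
Qed.

End measurable_rV.

Section lebesgue_rV.
Context {R : realType}.

Definition rV_cons n (p : measurableTypeR R * 'rV[R]_n) : 'rV[R]_n.+1 :=
  \row_i oapp (p.2 ord0) p.1 (unlift ord0 i).

Lemma measurable_rV_cons n : measurable_fun [set: _] (@rV_cons n).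
Proof.
apply: measurable_fun_rVP => i; case: (unliftP ord0 i) => [j|] ->.
  rewrite (_ : (fun _ => _) = (fun x : 'rV[R]_n => x ord0 j) \o snd).
    exact: measurableT_comp (measurable_rV_coord j) measurable_snd.
  by apply/funext => p /=; rewrite mxE liftK.
rewrite (_ : (fun _ => _) = fst); first exact: measurable_fst.
by apply/funext => p; rewrite mxE unlift_none.
Qed.


Section lebesgue_rVS.
Variables (n : nat) (mu : {sigma_finite_measure set 'rV[R]_n -> \bar R}).

Definition lebesgue_rVS : set 'rV[R]_n.+1 -> \bar R :=
  pushforward (@lebesgue_measure R \x mu)%E (@rV_cons n).

Let mcons := @measurable_rV_cons n.

Let lebesgue_rVS0 : lebesgue_rVS set0 = 0%E.
Proof. by rewrite /lebesgue_rVS /pushforward preimage_set0 measure0. Qed.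

Let lebesgue_rVS_ge0 A : (0 <= lebesgue_rVS A)%E.
Proof. exact: measure_ge0. Qed.

Let lebesgue_rVS_sigma_additive : semi_sigma_additive lebesgue_rVS.
Proof.
move=> F mF tF mUF.
exact: (@measure_semi_sigma_additive _ _ _
  (pushforward (@lebesgue_measure R \x mu)%E (@rV_cons n)) F mF tF mUF).
Qed.

HB.instance Definition _ := isMeasure.Build _ _ _ lebesgue_rVS
  lebesgue_rVS0 lebesgue_rVS_ge0 lebesgue_rVS_sigma_additive.

Let rV_uncons (x : 'rV[R]_n.+1) : measurableTypeR R * 'rV[R]_n :=
  (x ord0 ord0, \row_j x ord0 (lift ord0 j)).

Let rV_consK : cancel (@rV_cons n) rV_uncons.
Proof.
move=> [a x]; rewrite /rV_uncons /rV_cons !mxE unlift_none /=; congr pair.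
by apply/rowP => j; rewrite !mxE liftK.
Qed.

Let measurable_rV_uncons : measurable_fun [set: _] rV_uncons.
Proof.
apply/measurable_fun_pair; first exact: measurable_rV_coord.
apply: measurable_fun_rVP => i.
rewrite (_ : (fun _ => _) = (fun x : 'rV[R]_n.+1 => x ord0 (lift ord0 i))).
  exact: measurable_rV_coord.
by apply/funext => x; rewrite mxE.
Qed.

Let lebesgue_rVS_sigma_finite : sigma_finite setT lebesgue_rVS.
Proof.
have /sigma_finiteP[F [TF ndF Foo]] := sigma_finiteT (@lebesgue_measure R).
have /sigma_finiteP[G [TG ndG Goo]] := sigma_finiteT mu.
exists (fun k => rV_uncons @^-1` (F k `*` G k)).
  rewrite -preimage_bigcup (_ : \bigcup_i _ = setT) ?preimage_setT//.
  rewrite -setXTT TF TG predeqE => -[x y]; split.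
    by move=> [k _ []/= ? ?]; split; exists k.
  move=> [/= [k _ Fkx] [l _ Gly]]; exists (maxn k l) => //; split.
  - by move: x Fkx; exact/subsetPset/ndF/leq_maxl.
  - by move: y Gly; exact/subsetPset/ndG/leq_maxr.
move=> k; have [? ?] := Foo k; have [? ?] := Goo k.
have mFG : measurable (F k `*` G k) by exact: measurableX.
split; first by rewrite -[X in measurable X]setTI; exact: measurable_rV_uncons.
rewrite /lebesgue_rVS /pushforward -comp_preimage.
rewrite (_ : rV_uncons \o _ = id) ?preimage_id; last first.
  by apply/funext => z; exact: rV_consK.
by rewrite product_measure1E// lte_mul_pinfty// ge0_fin_numE.
Qed.

HB.instance Definition _ := Measure_isSigmaFinite.Build _ _ _ lebesgue_rVS
  lebesgue_rVS_sigma_finite.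

End lebesgue_rVS.

(* Lebesgue measure on R^n, as the n-fold product of the one on R. *)
Fixpoint lebesgue_rV n : {sigma_finite_measure set 'rV[R]_n -> \bar R} :=
  if n is m.+1 then lebesgue_rVS (lebesgue_rV m) else \d_(0 : 'rV[R]_0).

End lebesgue_rV.

Section euclidean.
Context {R : realType} {n : nat}.
Implicit Types x y : 'rV[R]_n.

Definition edot x y : R := \sum_i x ord0 i * y ord0 i.

Definition enorm x : R := Num.sqrt (edot x x).

Definition eball x (r : R) : set 'rV[R]_n := [set y | enorm (y - x) < r].

Definition enlarge (Omega : set 'rV[R]_n) (delta : R) : set 'rV[R]_n :=
  \bigcup_(x in Omega) eball x delta.

Lemma measurable_enorm : measurable_fun [set: 'rV[R]_n] enorm.
Proof.
apply: (@measurableT_comp _ _ _ _ _ _ (@Num.sqrt R)).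
  by apply: continuous_measurable_fun; exact: sqrt_continuous.
by apply: measurable_sum => i; apply: measurable_funM; exact: measurable_rV_coord.
Qed.

Definition enormalize x : 'rV[R]_n := (enorm x)^-1 *: x.

Lemma measurable_enormalize : measurable_fun [set: 'rV[R]_n] enormalize.
Proof.
apply: measurable_fun_rVP => i.
rewrite (_ : (fun _ => _) = (fun x => (enorm x `^ (-1)) * x ord0 i)).
  apply: measurable_funM; last exact: measurable_rV_coord.
  exact: (measurableT_comp (measurable_powR (-1)) measurable_enorm).
by apply/funext => x; rewrite mxE powR_inv1// sqrtr_ge0.
Qed.

Let punctured_ball : set 'rV[R]_n := [set x | 0 < enorm x <= 1].

Let measurable_punctured_ball : measurable punctured_ball.
Proof.
rewrite (_ : punctured_ball = enorm @^-1` `]0, 1]%classic); last first.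
  by apply/seteqP; split=> x /=; rewrite in_itv.
by rewrite -[X in measurable X]setTI; exact: measurable_enorm.
Qed.

Definition sphere : set 'rV[R]_n := [set x | enorm x = 1].

(* Surface measure on the unit sphere, from the polar decomposition
   dx = r^(n-1) dr ds: the set A has surface measure n times the volume of the
   cone {r s | 0 < r <= 1, s in A}. *)
Definition surface_measure (A : set 'rV[R]_n) : \bar R :=
  (n%:R%:E * lebesgue_rV n [set x | (0 < enorm x <= 1)%R /\ A (enormalize x)])%E.

Let surface_measure0 : surface_measure set0 = 0%E.
Proof.
rewrite /surface_measure (_ : [set _ | _] = set0) ?measure0 ?mule0//.
by apply/seteqP; split=> // x [].
Qed.

Let surface_measure_ge0 A : (0 <= surface_measure A)%E.
Proof. by apply: mule_ge0. Qed.

Let surface_measure_sigma_additive : semi_sigma_additive surface_measure.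
Proof.
have mn := measurable_enormalize.
pose nu := mscale (NngNum (ler0n R n)) (pushforward
  (mrestr (lebesgue_rV n) measurable_punctured_ball) enormalize).
have -> : surface_measure = nu mn.
  apply/funext => A; rewrite /surface_measure /nu /mscale /pushforward /mrestr.
  by congr (_ * lebesgue_rV n _)%E; rewrite setIC.
exact: measure_semi_sigma_additive.
Qed.

HB.instance Definition _ := isMeasure.Build _ _ _ surface_measure
  surface_measure0 surface_measure_ge0 surface_measure_sigma_additive.

End euclidean.

Section domain.
Context {R : realType} {n : nat}.

(* Near each boundary point, in suitable orthonormal coordinates whose last axis
   is nu, Omega is the strict epigraph of a Lipschitz function gamma, defined
   on the hyperplane orthogonal to nu. The point x has last coordinate
   edot x nu and orthogonal projection x - edot x nu *: nu. *)
Definition lipschitz_boundary (Omega : set 'rV[R]_n) :=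
  forall x0, closure Omega x0 -> ~ Omega^° x0 ->
  exists (r : R) (nu : 'rV[R]_n) (gamma : 'rV[R]_n -> R),
    [/\ 0 < r, enorm nu = 1,
        [lipschitz gamma x | x in [set x | edot x nu = 0]] &
        forall x, eball x0 r x ->
          (Omega x <-> gamma (x - edot x nu *: nu) < edot x nu)].

Definition lipschitz_domain (Omega : set 'rV[R]_n) :=
  [/\ Omega !=set0, open Omega, connected Omega, bounded_set Omega &
      lipschitz_boundary Omega].

End domain.

Section kernel.
Context {R : realType} {n : nat}.

(* K_{p,n}, computed with the unit vector e. *)
Definition Kpn (p : R) (e : 'rV[R]_n) : R :=
  (fine (surface_measure (@sphere R n)))^-1 *
  \int[surface_measure]_(s in sphere) (`|edot e s| `^ p).

Definition nl_kernel (p : R) (e : 'rV[R]_n) (delta : R) (w : 'rV[R]_n -> R) :=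
  [/\ measurable_fun [set: 'rV[R]_n] w,
      forall x, 0 <= w x,
      forall x y, enorm x = enorm y -> w x = w y,
      forall x, ~ eball 0 delta x -> w x = 0 &
      (\int[lebesgue_rV n]_x (enorm x `^ p * w x `^ p)%:E = (Kpn p e)^-1%:E)%E].

End kernel.

(* Elements of L^r(D) are represented by functions on the whole space, of which
   only the values on D matter: u \_ D is u extended by zero outside D.
   Functions equal a.e. on D represent the same element. *)
Definition Lr d (T : measurableType d) (R : realType)
    (mu : {measure set T -> \bar R}) (D : set T) (r : \bar R) : set (T -> R) :=
  [set u | (u \_ D) \in Lfun mu r].

Section weak_star.
Context {d} {T : measurableType d} {R : realType}.
Variables (mu : {measure set T -> \bar R}) (D : set T).

(* The weak* topology of L^oo(D) = L^1(D)^*: pointwise convergence of the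
   functionals g |-> \int_D k g. *)
Definition Linfty_pairing (k : T -> R) : {ptws {g | Lr mu D 1%E g} -> R} :=
  fun g => \int[mu]_(z in D) (k z * sval g z).

Definition weak_star := initial_topology Linfty_pairing.

End weak_star.

Section nonlocal.
Context {R : realType} {n : nat}.
Local Notation E := 'rV[R]_n.
Local Notation leb := (lebesgue_rV n).
Local Notation leb2 := (leb \x leb)%E.
Variables (p q : R) (Omega : set E) (delta : R) (w : E -> R).

Definition nl_dom : set (E * E) := enlarge Omega delta `*` enlarge Omega delta.
Local Notation D := nl_dom.

Definition nl_grad (u : E -> R) (z : E * E) : R :=
  ((u \_ Omega) z.1 - (u \_ Omega) z.2) * w (z.1 - z.2).

Definition U0 : set (E -> R) :=
  [set u | Lr leb Omega p%:E u /\ Lr leb2 D p%:E (nl_grad u)].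

(* The graph of the nonlocal divergence, the negative adjoint of nl_grad: sigma
   is in its domain and its divergence is g. As U0 is dense in L^p(Omega), g is
   determined by sigma up to equality a.e. on Omega. *)
Definition is_nl_div (sigma : E * E -> R) (g : E -> R) :=
  [/\ Lr leb2 D q%:E sigma, Lr leb Omega q%:E g &
      forall u, U0 u ->
        (\int[leb]_(x in Omega) (g x * u x)%:E =
         - \int[leb2]_(z in D) (sigma z * nl_grad u z)%:E)%E].

Definition Qdiv (f : E -> R) : set (E * E -> R) := [set sigma | is_nl_div sigma f].

Definition conductivities (klo khi : R) (A : set (E * E -> R)) :=
  [/\ A !=set0, A `<=` Lr leb2 D +oo%E,
      @convex_set R (E * E -> R^o) A,
      compact (A : set (weak_star leb2 D)) &
      forall k, A k ->
        {ae leb2, forall z, D z -> klo <= k z <= khi /\ k z = k (z.2, z.1)}].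

Local Open Scope ereal_scope.

Definition Ihat (k sigma : E * E -> R) : \bar R :=
  (q^-1)%:E * \int[leb2]_(z in D) ((k z `^ (1 - q)) * (`|sigma z| `^ q))%:E.

Definition Icheck (k : E * E -> R) (f u : E -> R) : \bar R :=
  (p^-1)%:E * \int[leb2]_(z in D) (k z * `|nl_grad u z| `^ p)%:E
  - \int[leb]_(x in Omega) (f x * u x)%:E.

Definition ihat k f := ereal_inf [set Ihat k sigma | sigma in Qdiv f].

Definition icheck k f := ereal_inf [set Icheck k f u | u in U0].

Definition lagrangian k f sigma g u :=
  Ihat k sigma + \int[leb]_(x in Omega) ((f x - g x) * u x)%:E.

(* sg ranges over the pairs of a field and its divergence. *)
Definition dual_obj k f u :=
  ereal_inf [set lagrangian k f sg.1 sg.2 u | sg in [set sg | is_nl_div sg.1 sg.2]].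

Definition dual_val k f := ereal_sup [set dual_obj k f u | u in Lr leb Omega p%:E].

Definition dual_solution k f u :=
  Lr leb Omega p%:E u /\ dual_obj k f u = dual_val k f.

Definition icheck_solution k f u := U0 u /\ Icheck k f u = icheck k f.

End nonlocal.

(* Main.v *)
Require Import Defs.
From mathcomp Require Import all_boot all_order all_algebra.
From mathcomp Require Import all_classical all_reals all_analysis.
From mathcomp Require Import measurable_realfun hoelder ring lra.

Set Implicit Arguments.
Unset Strict Implicit.
Unset Printing Implicit Defensive.
Import Order.TTheory GRing.Theory Num.Theory.
Import numFieldNormedType.Exports.
Local Open Scope classical_set_scope.
Local Open Scope ring_scope.

(* By Young's inequality, - Icheck u <= Ihat sigma + \int (f - D sigma) u for all
   admissible u and sigma, so the point is to find enough fields sigma in the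
   domain of the divergence. They come from the proximal problems
     minimise  1/p \int K |G u|^p + t/p \int |u - h|^p - \int f u,
   whose minimiser u yields the field sigma = - K |G u|^(p-2) G u, with
   divergence f - t |u - h|^(p-2) (u - h). Minimisers exist because uniform
   convexity and Poincare's inequality make minimising sequences Cauchy.
   For t = 0 this gives a primal-dual pair, hence strong duality. For f = 0, h = u
   and t -> oo, a lower bound on the dual objective at u bounds the energies of
   the minimisers and forces them to converge to u, so that u is admissible by
   Fatou's lemma: the dual objective is - Icheck u if u is admissible and -oo
   otherwise. *)

(** * Powers and their uniform convexity *)

(** The divergence is given only as an adjoint, for a general kernel, so no rich explicit family of
    fields in its domain is at hand; Euler-Lagrange equations of convex problems are what produces
    one. At an admissible u that is not optimal, the natural field - K |G u|^(p-2) G u may have no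
    divergence in L^q, so the infimum over sigma need not be attained and is approached along a
    family. The penalty t/p \int |u - h|^p provides it: its derivative lies in L^q and becomes part
    of the divergence. Strong convergence takes the place of weak compactness. The gradient is a
    pointwise formula, so almost everywhere convergence of functions passes to their gradients, and
    Fatou's lemma then gives lower semicontinuity. This closedness of G, its linearity and
    measurability, and Poincare's inequality are the hypotheses of the abstract problem, which is
    solved with real-valued integrals over whole spaces before being transferred to Omega and to
    extended real energies. *)

Lemma eq_ler {R : numDomainType} (x y : R) : x = y -> x <= y.
Proof. by move->. Qed.

Lemma ler_divr_le {R : realFieldType} (a r : R) : 1 < r -> 0 <= a -> a / r <= a.
Proof.
move=> r1 a0; have r0 := lt_trans ltr01 r1.
by rewrite ler_pdivrMr// ler_peMr// ltW.
Qed.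

Section scalar.
Context {R : realType}.
Variables (p q : R).
Hypotheses (p1 : 1 < p) (pq : p^-1 + q^-1 = 1).

(* [pw] is |x|^p and [p * dpw x], with dpw x = |x|^(p-2) x, its derivative. *)
Definition pw (x : R) : R := `|x| `^ p.

Definition dpw (x : R) : R := Num.sg x * `|x| `^ (p - 1).

Let p0 : 0 < p. Proof. exact: lt_trans p1. Qed.

Lemma conjugate_gt1 : 1 < q.
Proof.
have ip : p^-1 < 1 by rewrite invf_lt1.
have iqE : q^-1 = 1 - p^-1 by rewrite -pq addrC addKr.
have iq : 0 < q^-1 by rewrite iqE subr_gt0.
by rewrite -(invrK q) invf_gt1// iqE gtrBl invr_gt0.
Qed.

Let q0 : 0 < q. Proof. exact: lt_trans conjugate_gt1. Qed.

Lemma conjugateE : (p - 1) * q = p.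
Proof.
have : (p^-1 + q^-1) * (p * q) = p * q by rewrite pq mul1r.
have -> : (p^-1 + q^-1) * (p * q) = q + p.
  by field; rewrite !gt_eqF.
lra.
Qed.

Lemma pw_ge0 x : 0 <= pw x. Proof. exact: powR_ge0. Qed.

Lemma pw0 : pw 0 = 0. Proof. by rewrite /pw normr0 powR0// gt_eqF. Qed.

Lemma pwN x : pw (- x) = pw x. Proof. by rewrite /pw normrN. Qed.

Lemma pwM x y : pw (x * y) = pw x * pw y.
Proof. by rewrite /pw normrM powRM. Qed.

Lemma pw_eq0 x : pw x = 0 -> x = 0.
Proof. by move=> /powR_eq0_eq0 /normr0_eq0. Qed.

Lemma le_pw x y : `|x| <= y -> pw x <= pw y.
Proof.
move=> xy; rewrite /pw ge0_ler_powR ?nnegrE//; first exact: ltW.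
exact: le_trans xy (ler_norm _).
Qed.

Lemma dpw0 : dpw 0 = 0. Proof. by rewrite /dpw sgr0 mul0r. Qed.

Lemma dpwE x : dpw x * x = pw x.
Proof.
rewrite /dpw {3}(numEsg x) mulrACA -expr2 sqr_sg /pw.
have [->|x0] := eqVneq x 0; first by rewrite mul0r normr0 powR0// gt_eqF.
by rewrite mul1r mulrC mulr_powRB1.
Qed.

Lemma norm_dpw x : `|dpw x| = `|x| `^ (p - 1).
Proof.
have [->|x0] := eqVneq x 0.
  by rewrite dpw0 !normr0 powR0// subr_eq0 gt_eqF.
by rewrite /dpw normrM normr_sg x0 mul1r ger0_norm// powR_ge0.
Qed.

Lemma dpw_conjugate x : `|dpw x| `^ q = pw x.
Proof. by rewrite norm_dpw -powRrM conjugateE. Qed.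

Lemma dpw_young x y : `|dpw x * y| <= pw y / p + pw x / q.
Proof.
rewrite normrM mulrC -(dpw_conjugate x) /pw.
exact: conjugate_powR.
Qed.

(** Young's inequality [dpw_young], multiplied by p and with p / q = p - 1, is the tangent
    inequality of |x|^p; no differentiation is involved. *)
Lemma pw_tangent x y : pw x + p * (dpw x * (y - x)) <= pw y.
Proof.
have h : p * (dpw x * y) <= pw y + (p - 1) * pw x.
  have -> : pw y + (p - 1) * pw x = p * (pw y / p + pw x / q).
    by rewrite -[in p * (_ + _)]conjugateE; field; rewrite !gt_eqF// subr_gt0.
  rewrite ler_pM2l// (le_trans _ (dpw_young x y))//.
  exact: ler_norm.
rewrite mulrBr dpwE; lra.
Qed.

Lemma pw_midpoint x y : pw ((x + y) / 2) <= (pw x + pw y) / 2.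
Proof.
set m := (x + y) / 2.
have hx := pw_tangent m x; have hy := pw_tangent m y.
have : p * (dpw m * (x - m)) + p * (dpw m * (y - m)) = 0.
  by rewrite -mulrDr -mulrDr (_ : x - m + (y - m) = 0) ?mulr0// /m; field.
lra.
Qed.

(** The strict tangent inequality of the p-th power at m, taken at the point 1. For m > 0, writing
    the power as an exponential and using 1 + y <= exp y bounds the left side by exp ((p - 1) (ln m
    + 1 - m)), whose exponent is negative. *)
Lemma bernoulli_lt1 m : 0 <= m < 1 -> m `^ (p - 1) * (p - (p - 1) * m) < 1.
Proof.
move=> /andP[]; rewrite le_eqVlt => /predU1P[<-|m0] m1.
  by rewrite powR0 ?mul0r// subr_eq0 gt_eqF.
have p10 : 0 < p - 1 by rewrite subr_gt0.
have lnm : 1 + ln m < m.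
  rewrite -[ltRHS]lnK ?posrE//; apply: expR_gt1Dx.
  by rewrite lt_eqF// ln_lt0// m0.
rewrite /powR gt_eqF//.
have -> : p - (p - 1) * m = 1 + (p - 1) * (1 - m) by ring.
apply: (@le_lt_trans _ _ (expR ((p - 1) * ln m) * expR ((p - 1) * (1 - m)))).
  by rewrite ler_pM2l ?expR_gt0// expR_ge1Dx.
rewrite -expRD -mulrDr -[ltRHS]expR0 ltr_expR pmulr_rlt0//; lra.
Qed.

(** Of the two tangent inequalities at the midpoint, the one towards 1 is strict by [bernoulli_lt1];
    in their sum the slope terms cancel. *)
Lemma pw_midpoint_lt x : -1 <= x -> x < 1 -> pw ((x + 1) / 2) < (pw x + 1) / 2.
Proof.
move=> x1 x2; set m := (x + 1) / 2.
have hx := pw_tangent m x.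
have m0 : 0 <= m by rewrite /m; lra.
have m1 : m < 1 by rewrite /m; lra.
have hy : pw m + p * (dpw m * (1 - m)) < 1.
  have := @bernoulli_lt1 m; rewrite m0 m1 => /(_ isT).
  have dm : dpw m = m `^ (p - 1).
    rewrite /dpw ger0_norm//; move: m0; rewrite le_eqVlt => /predU1P[<-|m0].
      by rewrite sgr0 powR0 ?mul0r// subr_eq0 gt_eqF.
    by rewrite gtr0_sg// mul1r.
  by rewrite -dpwE dm; lra.
have : p * (dpw m * (x - m)) + p * (dpw m * (1 - m)) = 0.
  by rewrite -mulrDr -mulrDr (_ : x - m + (1 - m) = 0) ?mulr0// /m; field.
lra.
Qed.

Lemma continuous_normr_powR r : 0 < r -> continuous (fun x : R => `|x| `^ r).
Proof.
move=> r0 x; have [->|x0] := eqVneq x 0.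
  rewrite /continuous_at normr0 powR0 ?gt_eqF//.
  apply/cvgrPdist_le => /= e e0; near=> y.
  rewrite sub0r normrN ger0_norm ?powR_ge0//.
  have -> : e = (e `^ r^-1) `^ r by rewrite -powRrM mulVf ?gt_eqF// powRr1// ltW.
  rewrite ge0_ler_powR ?nnegrE ?powR_ge0//; first exact: ltW.
  near: y; apply/nbhs_normP; exists (e `^ r^-1) => /=; first exact: powR_gt0.
  by move=> y /=; rewrite sub0r normrN => /ltW.
have hx : \forall y \near x, expR (r * ln `|y|) = `|y| `^ r.
  near=> y; rewrite /powR normr_eq0 ifF//; apply/negbTE.
  by near: y; exact: (open_neq x0).
rewrite /continuous_at -(nbhs_singleton hx).
apply: cvg_trans; first by apply: near_eq_cvg; exact: hx.
have hln : ln `|y| @[y --> x] --> ln `|x|.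
  have hn : `|y| @[y --> x] --> `|x| by exact: (@norm_continuous _ R^o x).
  apply: (cvg_comp _ _ hn).
  by apply: continuous_ln; rewrite normr_gt0.
apply: (cvg_comp (fun y : R => r * ln `|y|) expR); last exact: continuous_expR.
exact: cvgM (cvg_cst _) hln.
Unshelve. all: by end_near. Qed.

Lemma continuous_pw : continuous pw.
Proof. exact: continuous_normr_powR. Qed.

Lemma continuous_dpw : continuous dpw.
Proof.
have p10 : 0 < p - 1 by rewrite subr_gt0.
move=> x; have [->|x0] := eqVneq x 0.
  rewrite /continuous_at dpw0; apply/norm_cvg0P.
  have := @continuous_normr_powR (p - 1) p10 0.
  rewrite /continuous_at normr0 powR0 ?gt_eqF//.
  by apply: cvg_trans; apply: near_eq_cvg; near=> y; rewrite /= norm_dpw.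
have hx : \forall y \near x, Num.sg x * `|y| `^ (p - 1) = dpw y.
  move: x0; rewrite neq_lt => /orP[x0|x0]; near=> y.
    have y0 : y < 0 by near: y; exact: lt_nbhsl.
    by rewrite /dpw !ltr0_sg.
  have y0 : 0 < y by near: y; exact: lt_nbhsr.
  by rewrite /dpw !gtr0_sg.
rewrite /continuous_at -(nbhs_singleton hx).
apply: cvg_trans; first by apply: near_eq_cvg; exact: hx.
by apply: cvgM; [exact: cvg_cst|exact: continuous_normr_powR].
Unshelve. all: by end_near. Qed.

(* By homogeneity one may take |x| <= y = 1, and then the convexity gap is
   bounded below by compactness as long as x stays away from 1. *)
Lemma pw_uniform_convexity e : 0 < e -> exists2 C, 0 < C & forall x y,
  pw (x - y) <= e * (pw x + pw y) + C * ((pw x + pw y) / 2 - pw ((x + y) / 2)).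
Proof.
move=> e0; pose gap s := (pw s + 1) / 2 - pw ((s + 1) / 2).
(* For s within [h] of 1 the left side is at most h^p <= e, so the gap is needed only on
   [-1, 1 - h], where its minimum is positive. *)
pose h := Num.min 1 (e `^ p^-1).
have h0 : 0 < h by rewrite lt_min ltr01 powR_gt0.
have h1 : h <= 1 by rewrite ge_min lexx.
have he : h `^ p <= e.
  have -> : e = (e `^ p^-1) `^ p by rewrite -powRrM mulVf ?gt_eqF// powRr1// ltW.
  apply: ge0_ler_powR; rewrite ?nnegrE ?powR_ge0//; [exact: ltW|exact: ltW|].
  by rewrite ge_min lexx orbT.
have cgap : continuous gap.
  move=> s; have hs : (s' + 1) / 2 @[s' --> s] --> (s + 1) / 2.
    by apply: cvgM; [apply: cvgD; [exact: cvg_id|exact: cvg_cst]|exact: cvg_cst].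
  apply: cvgB; last exact: (cvg_comp _ _ hs (@continuous_pw _)).
  apply: cvgM; last exact: cvg_cst.
  by apply: cvgD; [exact: continuous_pw|exact: cvg_cst].
have [] := @EVT_min _ gap (-1) (1 - h); first lra.
  exact: continuous_subspaceT.
move=> s0; rewrite in_itv/= => /andP[s01 s02] mins0.
have c0 : 0 < gap s0 by rewrite subr_gt0 pw_midpoint_lt//; lra.
(* The constant comes from |s - 1| <= 2 and from gap s >= gap s0 away from 1. *)
have gap_bound s : -1 <= s <= 1 -> pw (s - 1) <= e + pw 2 / gap s0 * gap s.
  move=> /andP[s1 s2].
  have gs : 0 <= gap s.
    rewrite subr_ge0; have := pw_midpoint s 1.
    by rewrite /pw normr1 powR1.
  have [hs|hs] := leP s (1 - h).
    have : gap s0 <= gap s by apply: mins0; rewrite in_itv/= s1.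
    move=> gg; apply: (@le_trans _ _ (pw 2)).
      by apply: le_pw; rewrite ler_norml; lra.
    rewrite -[leLHS]add0r lerD//; first exact: ltW.
    by rewrite -mulrA ler_peMr ?pw_ge0// mulrC ler_pdivlMr// mul1r.
  have pg : 0 <= pw 2 / gap s0 by rewrite divr_ge0 ?pw_ge0// ltW.
  rewrite -[leLHS]addr0 lerD ?(mulr_ge0 pg)//.
  apply: le_trans he; rewrite /pw.
  apply: ge0_ler_powR; rewrite ?nnegrE//; [exact: ltW|exact: ltW|].
  by rewrite ler_norml; lra.
have wkey x y : `|x| <= `|y| -> pw (x - y) <= e * (pw x + pw y) +
    pw 2 / gap s0 * ((pw x + pw y) / 2 - pw ((x + y) / 2)).
  move=> xy; have [y0|y0] := eqVneq y 0.
    move: xy; rewrite y0 normr0 normr_le0 => /eqP ->.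
    by rewrite !(addr0, subr0, pw0, mul0r, mulr0).
  have ny : 0 < `|y| by rewrite normr_gt0.
  have := gap_bound (x / y); rewrite -ler_norml normrM normfV ler_pdivrMr// mul1r.
  move=> /(_ xy); rewrite -(ler_pM2r (_ : 0 < pw y)); last first.
    by rewrite /pw powR_gt0.
  rewrite -pwM mulrBl mul1r mulfVK//; move=> /le_trans; apply.
  rewrite mulrDl lerD//; first by rewrite ler_pM2l// lerDr pw_ge0.
  rewrite -(mulrA _ (gap _)) (_ : gap (x / y) * pw y = (pw x + pw y) / 2 - pw ((x + y) / 2))//.
  rewrite /gap mulrBl -pwM mulrAC mulrDl -pwM mul1r mulfVK//.
  by rewrite (_ : (x / y + 1) / 2 * y = (x + y) / 2)//; field.
exists (pw 2 / gap s0); first by rewrite divr_gt0// /pw powR_gt0// normr_gt0 pnatr_eq0.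
move=> x y; have [xy|/ltW yx] := leP `|x| `|y|; first exact: wkey.
by rewrite -pwN opprB [pw x + _]addrC [x + y]addrC; exact: wkey.
Qed.

End scalar.

(** * Integration *)

Section Lfun_theory.
Context d (T : measurableType d) (R : realType).
Variable mu : {measure set T -> \bar R}.
Variables (p q : R).
Hypotheses (p1 : 1 < p) (pq : p^-1 + q^-1 = 1).
Implicit Types f g : T -> R.

Lemma measurable_pw f :
  measurable_fun [set: T] f -> measurable_fun [set: T] (fun x => pw p (f x)).
Proof.
by move=> mf; apply: (measurableT_comp (measurable_powR _));
  exact: measurableT_comp.
Qed.

Lemma measurable_dpw f :
  measurable_fun [set: T] f -> measurable_fun [set: T] (fun x => dpw p (f x)).
Proof.
move=> mf; apply: (measurableT_comp _ mf).
by apply: continuous_measurable_fun; exact: continuous_dpw.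
Qed.

Lemma Lfun_measurable f : f \in Lfun mu p%:E -> measurable_fun [set: T] f.
Proof. by rewrite inE => /andP[/[!inE]]. Qed.

Lemma Lfun_pw f : f \in Lfun mu p%:E ->
  mu.-integrable [set: T] (EFin \o (fun x => pw p (f x))).
Proof. by move=> /(Lfun_integrable (ltW p1)). Qed.

Lemma pw_Lfun f : measurable_fun [set: T] f ->
  (\int[mu]_x (pw p (f x))%:E < +oo)%E -> f \in Lfun mu p%:E.
Proof.
move=> mf foo; rewrite inE; apply/andP; split; rewrite inE//=.
rewrite /finite_norm unlock poweR_lty//.
Qed.

Lemma LfunDZ c f g : f \in Lfun mu p%:E -> g \in Lfun mu p%:E ->
  (fun x => f x + c * g x) \in Lfun mu p%:E.
Proof.
move=> fp gp.
have p1' : (1 <= p%:E)%E by rewrite lee_fin ltW.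
have [_ h] := Lfun_submod_closed mu p1'.
have := h c g f gp fp; rewrite (_ : c *: g + f = fun x => f x + c * g x)//.
by apply/funext => x; rewrite addrC.
Qed.

Lemma LfunB f g : f \in Lfun mu p%:E -> g \in Lfun mu p%:E ->
  (fun x => f x - g x) \in Lfun mu p%:E.
Proof.
move=> fp gp; rewrite (_ : (fun _ => _) = fun x => f x + (-1) * g x).
  exact: LfunDZ.
by apply/funext => x; rewrite mulN1r.
Qed.

Lemma Lfun_mul f g : f \in Lfun mu p%:E -> g \in Lfun mu q%:E ->
  mu.-integrable [set: T] (EFin \o (fun x => f x * g x)).
Proof.
move=> fp gq.
have q1 := conjugate_gt1 p1 pq.
have mf := Lfun_measurable fp.
have mg : measurable_fun [set: T] g by move: gq; rewrite inE => /andP[/[!inE]].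
have ig := Lfun_integrable (ltW q1) gq.
have h : mu.-integrable [set: T]
    (EFin \o (fun x => pw p (f x) + `|g x| `^ q)).
  by apply: (@integrableD _ _ _ mu _ measurableT _ _ (Lfun_pw fp) ig).
apply: le_integrable h => //; first by apply/measurable_EFinP; exact: measurable_funM.
move=> x _; rewrite /= lee_fin normrM.
have p0 : 0 < p by exact: lt_trans p1.
have q0 : 0 < q by exact: lt_trans q1.
apply: (le_trans (conjugate_powR (normr_ge0 (f x)) (normr_ge0 (g x)) p0 q0 pq)).
rewrite [leRHS]ger0_norm ?addr_ge0 ?powR_ge0//.
by apply: lerD; apply: ler_divr_le => //; exact: powR_ge0.
Qed.

End Lfun_theory.

(** * Fatou's lemma and almost everywhere convergence *)

Section convergence.
Context d (T : measurableType d) (R : realType).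
Variable mu : {measure set T -> \bar R}.

(** Fatou's lemma in a form suited to [near]: every level strictly below the integral of the limit
    is eventually exceeded. That integral may be infinite, so the lemma also serves to prove
    integrability of limits. *)
Lemma fatou_lt (g_ : nat -> T -> R) (g : T -> R) (c : \bar R) :
  (forall k, measurable_fun [set: T] (g_ k)) -> (forall k x, 0 <= g_ k x) ->
  measurable_fun [set: T] g -> (forall x, 0 <= g x) ->
  {ae mu, forall x, g_ ^~ x @ \oo --> g x} ->
  (c < \int[mu]_x (g x)%:E)%E ->
  \forall k \near \oo, (c < \int[mu]_x (g_ k x)%:E)%E.
Proof.
move=> mg_ g_0 mg g0 gg cg.
have mEg_ k : measurable_fun [set: T] (EFin \o g_ k) by apply/measurable_EFinP.
have : (\int[mu]_x (g x)%:E <= limn_einf (fun k => \int[mu]_x (g_ k x)%:E))%E.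
  have Eg_0 k x : [set: T] x -> (0 <= (EFin \o g_ k) x)%E.
    by move=> _; rewrite lee_fin.
  apply: le_trans (@fatou _ T R mu _ measurableT _ mEg_ Eg_0).
  apply: ae_ge0_le_integral => //.
  - by move=> x _; rewrite lee_fin.
  - by apply/measurable_EFinP.
  - move=> x _; rewrite limn_einf_lim; apply: lime_ge; first exact: is_cvg_einfs.
    apply: nearW => k; apply: le_ereal_inf_tmp => _ [m /= _ <-]; rewrite lee_fin//.
  - rewrite /limn_einf; apply: measurableT_comp => //.
    by apply: measurable_fun_limn_esup => k; exact: measurableT_comp.
  apply: filterS gg => x gx _.
  have egx : (fun k => (g_ k x)%:E) @ \oo --> (g x)%:E.
    by apply: cvg_EFin => //; exact: nearW.
  by have [-> _] := cvg_limn_einf_sup egx.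
move=> /(lt_le_trans cg); rewrite limn_einf_lim.
rewrite (cvg_lim _ (@cvg_einfs_sup _ _))//.
move=> /ereal_sup_gt[_ [N _ <-] cN].
exists N => // k /= Nk; apply: (lt_le_trans cN).
by apply: ereal_inf_lbound; exists k.
Qed.

Lemma fatou_le (g_ : nat -> T -> R) (g : T -> R) (c : R) :
  (forall k, measurable_fun [set: T] (g_ k)) -> (forall k x, 0 <= g_ k x) ->
  measurable_fun [set: T] g -> (forall x, 0 <= g x) ->
  {ae mu, forall x, g_ ^~ x @ \oo --> g x} ->
  (\forall k \near \oo, (\int[mu]_x (g_ k x)%:E <= c%:E)%E) ->
  (\int[mu]_x (g x)%:E <= c%:E)%E.
Proof.
move=> mg_ g_0 mg g0 gg gc; rewrite leNgt; apply/negP => cg.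
have h := fatou_lt mg_ g_0 mg g0 gg cg.
near \oo => k.
have : (\int[mu]_x (g_ k x)%:E <= c%:E)%E by near: k.
by rewrite leNgt => /negP; apply; near: k.
Unshelve. all: by end_near. Qed.

(** The bounds sum to 1, so the series of the functions has a finite integral, is finite almost
    everywhere, and its terms tend to 0 there. *)
Lemma ae_cvg0 (g_ : nat -> T -> R) :
  (forall k, measurable_fun [set: T] (g_ k)) -> (forall k x, 0 <= g_ k x) ->
  (forall k, (\int[mu]_x (g_ k x)%:E <= (1 / (2 ^ (k + 1))%:R)%:E)%E) ->
  {ae mu, forall x, g_ ^~ x @ \oo --> (0 : R)}.
Proof.
move=> mg_ g_0 gc.
have mEg_ k : measurable_fun [set: T] (EFin \o g_ k) by apply/measurable_EFinP.
have Eg_0 k x : [set: T] x -> (0 <= (EFin \o g_ k) x)%E.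
  by move=> _; rewrite lee_fin.
pose F x := (\sum_(k <oo) (g_ k x)%:E)%E.
have F0 x : (0 <= F x)%E by apply: nneseries_ge0 => k _ _; rewrite lee_fin.
have mF : measurable_fun [set: T] F.
  apply: (@ge0_emeasurable_sum _ _ _ _ (fun k => EFin \o g_ k) xpredT).
    by move=> k x Tx _; exact: Eg_0.
  by move=> k _; exact: mEg_.
have iF : (\int[mu]_x F x <= 1%:E)%E.
  rewrite (integral_nneseries mu measurableT mEg_ Eg_0).
  apply: (@le_trans _ _ (\sum_(k <oo) (1 / (2 ^ (k + 1))%:R)%:E)%E).
    by apply: lee_nneseries => [k _ _|k _]; [exact: integral_ge0 (Eg_0 k)|exact: gc].
  by rewrite (cvg_lim _ (@cvg_geometric_eseries_half R 1 0))// expr0 divr1.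
have : mu.-integrable [set: T] F.
  apply/integrableP; split=> //.
  under eq_integral do rewrite gee0_abs//.
  exact: le_lt_trans iF (ltry _).
move=> /(integrable_ae measurableT); apply: filterS => x /(_ I) Fx.
apply: cvg_series_cvg_0; apply: nondecreasing_is_cvgn.
  apply/nondecreasing_seqP => k; rewrite !seriesEnat/= big_nat_recr//= lerDl//.
exists (fine (F x)) => _ [k _ <-].
rewrite -lee_fin fineK// seriesEnat/= -sumEFin.
by apply: nneseries_lim_ge => i _ _; rewrite lee_fin.
Qed.

(** The Riesz-Fischer argument: by [ae_cvg0] the increments are eventually below 2^-k almost
    everywhere, so the telescoping series is dominated by a geometric one. *)
Lemma ae_is_cvg (p : R) (u_ : nat -> T -> R) : 0 < p ->
  (forall k, measurable_fun [set: T] (u_ k)) ->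
  (forall k, (\int[mu]_x (pw p (2 ^+ k * (u_ k.+1 x - u_ k x)))%:E <=
             (1 / (2 ^ (k + 1))%:R)%:E)%E) ->
  {ae mu, forall x, cvgn (u_ ^~ x)}.
Proof.
move=> p0 mu_ uc.
have : {ae mu, forall x,
    (fun k => pw p (2 ^+ k * (u_ k.+1 x - u_ k x))) @ \oo --> (0 : R)}.
  apply: ae_cvg0 => //; last by move=> k x; exact: powR_ge0.
  move=> k; apply: measurable_pw => //; apply: measurable_funM => //.
  exact: measurable_funB.
apply: filterS => x ux.
have : \forall k \near \oo, pw p (2 ^+ k * (u_ k.+1 x - u_ k x)) < 1.
  by move/cvgrPdist_lt : ux => /(_ _ ltr01); apply: filterS => k;
    rewrite sub0r normrN; apply: le_lt_trans; exact: ler_norm.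
move=> [N _ hN].
suff: cvgn (fun k => u_ (k + N)%N x).
  move=> /cvg_ex[/= l ul]; apply/cvg_ex; exists l.
  by move: ul; rewrite (cvg_shiftn N (u_ ^~ x)).
have -> : (fun k => u_ (k + N)%N x) =
    cst (u_ N x) \+ series (telescope (fun k => u_ (k + N)%N x)).
  by apply/funext => k; rewrite [LHS](@eq_sum_telescope _ (fun k => u_ (k + N)%N x)).
apply: is_cvgD; first exact: is_cvg_cst.
apply: normed_cvg.
apply: (@series_le_cvg _ _ (geometric 1 2^-1)) => [k|k|k|].
- exact: normr_ge0.
- by rewrite /= mul1r exprn_ge0.
- rewrite /= /telescope mul1r.
  have : pw p (2 ^+ (k + N) * (u_ (k + N).+1 x - u_ (k + N)%N x)) < 1.
    by apply: hN => /=; rewrite leq_addl.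
  move=> h; have {h} : `|2 ^+ (k + N) * (u_ (k + N).+1 x - u_ (k + N)%N x)| < 1.
    rewrite ltNge; apply/negP => h1; move: h; rewrite ltNge => /negP; apply.
    apply: (@le_trans _ _ (1 `^ p)); first by rewrite powR1.
    rewrite /pw; apply: ge0_ler_powR; rewrite ?nnegrE//.
    exact: ltW.
  rewrite normrM ger0_norm ?exprn_ge0// -ltr_pdivlMl ?exprn_gt0// mulr1.
  move=> /ltW /le_trans; apply.
  rewrite exprVn lef_pV2 ?posrE ?exprn_gt0//.
  by rewrite ler_weXn2l ?leq_addr// ler1n.
- by apply: is_cvg_geometric_series; rewrite ger0_norm// invf_lt1// ltr1n.
Qed.

(** The functions are set to 0 on a measurable null set containing all bad points, so that the limit
    exists everywhere and is measurable. The last clause keeps the limit equal to 0 outside the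
    domain. *)
Lemma ae_cvg_measurable (u_ : nat -> T -> R) :
  (forall k, measurable_fun [set: T] (u_ k)) ->
  {ae mu, forall x, cvgn (u_ ^~ x)} ->
  exists u : T -> R, [/\ measurable_fun [set: T] u,
    {ae mu, forall x, u_ ^~ x @ \oo --> u x} &
    forall x, (forall k, u_ k x = 0) -> u x = 0].
Proof.
move=> mu_ [N [mN N0 sN]].
pose v_ k := u_ k \_ (~` N).
have mv_ k : measurable_fun [set: T] (v_ k).
  by apply/(measurable_restrictT _ (measurableC mN)); exact: measurable_funTS.
have cv x : cvgn (v_ ^~ x).
  have [Nx|Nx] := pselect (N x).
    rewrite (_ : v_ ^~ x = cst 0); first exact: is_cvg_cst.
    by apply/funext => k; rewrite /v_ patchE memNset// => /(_ Nx).
  have -> : v_ ^~ x = u_ ^~ x.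
    by apply/funext => k; rewrite /v_ patchE mem_set.
  by apply: contrapT => h; apply: Nx; apply: sN.
exists (fun x => limn (v_ ^~ x)); split.
- by apply: (measurable_fun_cvg mv_) => x _; exact: cv.
- exists N; split => // x /= h; apply: contrapT => Nx; apply: h.
  have <- : v_ ^~ x = u_ ^~ x.
    by apply/funext => k; rewrite /v_ patchE mem_set.
  exact: cv.
- move=> x ux; rewrite (_ : v_ ^~ x = cst 0) ?lim_cst//.
  by apply/funext => k; rewrite /v_ patchE; case: ifP => // _; rewrite ux.
Qed.

End convergence.

(** * Real-valued integrals over the whole space *)

Section rint.
Context d (T : measurableType d) (R : realType).
Variable mu : {measure set T -> \bar R}.
Implicit Types f g : T -> R.

Definition rint f := mu.-integrable [set: T] (EFin \o f).

Lemma rintD f g : rint f -> rint g -> rint (fun x => f x + g x).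
Proof. by move=> rf rg; exact: (integrableD measurableT rf rg). Qed.

Lemma rintZ c f : rint f -> rint (fun x => c * f x).
Proof. by move=> rf; exact: (integrableZl measurableT c rf). Qed.

Lemma rintB f g : rint f -> rint g -> rint (fun x => f x - g x).
Proof. by move=> rf rg; exact: (integrableB measurableT rf rg). Qed.

Lemma rint_le f g : measurable_fun [set: T] f -> rint g ->
  (forall x, `|f x| <= g x) -> rint f.
Proof.
move=> mf rg fg; apply: le_integrable rg => //; first exact/measurable_EFinP.
by move=> x _; rewrite /= lee_fin (le_trans (fg x))// ler_norm.
Qed.

Lemma EFin_rint f : rint f ->
  (\int[mu]_x (f x)%:E)%E = (\int[mu]_x f x)%:E.
Proof. by move=> rf; rewrite /Rintegral fineK//; exact: integrable_fin_num. Qed.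

Lemma RintD f g : rint f -> rint g ->
  \int[mu]_x (f x + g x) = \int[mu]_x f x + \int[mu]_x g x.
Proof. exact: RintegralD. Qed.

Lemma RintB f g : rint f -> rint g ->
  \int[mu]_x (f x - g x) = \int[mu]_x f x - \int[mu]_x g x.
Proof. exact: RintegralB. Qed.

Lemma RintZ c f : rint f -> \int[mu]_x (c * f x) = c * \int[mu]_x f x.
Proof. by move=> rf; exact: RintegralZl. Qed.

Lemma eq_Rint f g : f =1 g -> \int[mu]_x f x = \int[mu]_x g x.
Proof. by move=> fg; apply: eq_Rintegral => x _; exact: fg. Qed.

Lemma le_Rint f g : rint f -> rint g -> (forall x, f x <= g x) ->
  \int[mu]_x f x <= \int[mu]_x g x.
Proof. by move=> rf rg fg; apply: le_Rintegral => // x _; exact: fg. Qed.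

Lemma ge0_rint f c : measurable_fun [set: T] f -> (forall x, 0 <= f x) ->
  (\int[mu]_x (f x)%:E <= c%:E)%E -> rint f.
Proof.
move=> mf f0 fc; apply/integrableP; split; first exact/measurable_EFinP.
under eq_integral do rewrite gee0_abs ?lee_fin//.
exact: le_lt_trans fc (ltry _).
Qed.

Lemma fatou_near (g_ : nat -> T -> R) g e : 0 < e ->
  (forall k, rint (g_ k)) -> (forall k x, 0 <= g_ k x) ->
  rint g -> (forall x, 0 <= g x) ->
  {ae mu, forall x, g_ ^~ x @ \oo --> g x} ->
  \forall k \near \oo, \int[mu]_x g x - e <= \int[mu]_x g_ k x.
Proof.
move=> e0 rg_ g_0 rg g0 gg.
have mrint h : rint h -> measurable_fun [set: T] h.
  by move=> /integrableP[/measurable_EFinP].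
have h : ((\int[mu]_x g x - e)%:E < \int[mu]_x (g x)%:E)%E.
  by rewrite EFin_rint// lte_fin ltrBlDr ltrDl.
have := fatou_lt (fun k => mrint _ (rg_ k)) g_0 (mrint _ rg) g0 gg h.
by apply: filterS => k; rewrite EFin_rint// lte_fin => /ltW.
Qed.

End rint.

(** * Linear forms and first variations on L^p *)

Section Lp_estimates.
Context d (T : measurableType d) (R : realType).
Variable mu : {measure set T -> \bar R}.
Variables (p q : R).
Hypotheses (p1 : 1 < p) (pq : p^-1 + q^-1 = 1).
Implicit Types a b f : T -> R.

Let p0 : 0 < p. Proof. exact: lt_trans p1. Qed.
Let q1 : 1 < q. Proof. exact: conjugate_gt1 p1 pq. Qed.
Let q0 : 0 < q. Proof. exact: lt_trans q1. Qed.

Lemma Lfun_mulr f b : f \in Lfun mu q%:E -> b \in Lfun mu p%:E ->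
  rint mu (fun x => f x * b x).
Proof.
move=> fq bp; rewrite (_ : (fun _ => _) = fun x => b x * f x).
  exact: (Lfun_mul p1 pq).
by apply/funext => x; rewrite mulrC.
Qed.

(** Young's inequality for the product of s b and f / s. A small s makes the p-th power term small,
    a large s the constant term; [linear_form_coercive] exploits the former and
    [linear_form_continuous] the latter. *)
Lemma weighted_young_int s f : 0 < s -> f \in Lfun mu q%:E ->
  forall b, b \in Lfun mu p%:E ->
  \int[mu]_x (f x * b x) <=
  s `^ p * \int[mu]_x pw p (b x) + s `^ (- q) * \int[mu]_x pw q (f x).
Proof.
move=> s0 fq b bp.
have rb := Lfun_pw p1 bp; have rf := Lfun_pw q1 fq.
rewrite -RintZ// -RintZ// -RintD; [|exact: rintZ|exact: rintZ].
apply: le_Rint.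
- exact: Lfun_mulr.
- by apply: rintD; exact: rintZ.
move=> x; apply: (le_trans (ler_norm _)).
have -> : f x * b x = (s * b x) * (s^-1 * f x).
  by rewrite mulrACA mulfV ?gt_eqF// mul1r mulrC.
rewrite normrM; apply: (le_trans (conjugate_powR _ _ p0 q0 pq)) => //.
apply: lerD.
  apply: (le_trans (ler_divr_le p1 (powR_ge0 _ _))).
  by rewrite normrM powRM// (ger0_norm (ltW s0)).
apply: (le_trans (ler_divr_le q1 (powR_ge0 _ _))).
by rewrite normrM powRM// normfV (ger0_norm (ltW s0)) -(powR_inv1 (ltW s0)) -powRrM mulN1r.
Qed.

Lemma linear_form_coercive e f : 0 < e -> f \in Lfun mu q%:E ->
  exists c, forall b, b \in Lfun mu p%:E ->
  \int[mu]_x (f x * b x) <= e * \int[mu]_x pw p (b x) + c.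
Proof.
move=> e0 fq; pose s := e `^ p^-1.
exists (s `^ (- q) * \int[mu]_x pw q (f x)) => b bp.
have := weighted_young_int (powR_gt0 p^-1 e0) fq bp.
by rewrite -/s -(powRrM e) mulVf ?gt_eqF// powRr1// ltW.
Qed.

Lemma linear_form_continuous e f : 0 < e -> f \in Lfun mu q%:E ->
  exists2 c, 0 < c & forall b, b \in Lfun mu p%:E ->
  \int[mu]_x (f x * b x) <= c * \int[mu]_x pw p (b x) + e.
Proof.
move=> e0 fq.
pose F := \int[mu]_x pw q (f x).
have F0 : 0 <= F by apply: Rintegral_ge0 => x _; exact: pw_ge0.
(* Below, [s] is chosen with s^(-q) = r, so that r F <= e; the + 1 keeps the denominator positive
   when f vanishes. *)
pose r := e / (F + 1).
have r0 : 0 < r by rewrite divr_gt0// ltr_wpDl.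
pose s := r `^ (- q^-1).
have s0 : 0 < s by exact: powR_gt0.
exists (s `^ p); first exact: powR_gt0.
move=> b bp; apply: (le_trans (weighted_young_int s0 fq bp)).
rewrite lerD2l -powRrM mulrNN mulVf ?gt_eqF// powRr1 ?(ltW r0)// -/F /r.
by rewrite mulrAC ler_pdivrMr ?ltr_wpDl// ler_pM2l// lerDl.
Qed.

Lemma normr_Lfun a : a \in Lfun mu p%:E -> (fun x => `|a x|) \in Lfun mu p%:E.
Proof.
move=> ap; have ma := Lfun_measurable ap.
apply: pw_Lfun => //; first exact: measurableT_comp.
under eq_integral do rewrite /pw normr_id -/(pw _ _).
by rewrite EFin_rint ?ltry//; exact: Lfun_pw.
Qed.

Lemma dpw_Lfun a : a \in Lfun mu p%:E -> (fun x => dpw p (a x)) \in Lfun mu q%:E.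
Proof.
move=> ap; have ma := Lfun_measurable ap.
apply: pw_Lfun => //; first exact: measurable_dpw.
under eq_integral do rewrite /pw (dpw_conjugate p1 pq) -/(pw _ _).
rewrite EFin_rint ?ltry//; exact: Lfun_pw.
Qed.

Lemma bounded_mul_rint (K : T -> R) M f : measurable_fun [set: T] K ->
  (forall x, 0 <= K x <= M) -> rint mu f -> rint mu (fun x => K x * f x).
Proof.
move=> mK KM rf.
have /integrableP[/measurable_EFinP mf _] := rf.
have rn : rint mu (fun x => `|f x|) by exact: (integrable_norm rf).
apply: (@rint_le _ _ _ _ _ (fun x => M * `|f x|)); last first.
- move=> x; have /andP[K0 KMx] := KM x.
  by rewrite normrM (ger0_norm K0) ler_wpM2r.
- exact: rintZ.
- exact: measurable_funM.
Qed.

(** Dominated convergence: the steps 1 / (k + 1) are at most 1, so Young's inequality bounds the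
    integrands by M (|b|^p + (|a| + |b|)^p). The limit is the first variation of 1/p \int K |a|^p in
    the direction b. *)
Lemma cvg_int_dpw (K : T -> R) M a b : measurable_fun [set: T] K ->
  (forall x, 0 <= K x <= M) -> a \in Lfun mu p%:E -> b \in Lfun mu p%:E ->
  \int[mu]_x (K x * (dpw p (a x + k.+1%:R^-1 * b x) * b x)) @[k --> \oo] -->
  \int[mu]_x (K x * (dpw p (a x) * b x)).
Proof.
move=> mK KM ap bp.
have ma := Lfun_measurable ap; have mb := Lfun_measurable bp.
pose c x := `|a x| + 1 * `|b x|.
have cp : c \in Lfun mu p%:E by apply: LfunDZ => //; exact: normr_Lfun.
have rg : rint mu (fun x => M * (pw p (b x) + pw p (c x))).
  by apply: rintZ; apply: rintD; exact: Lfun_pw.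
have mF k : measurable_fun [set: T]
    (fun x => K x * (dpw p (a x + k.+1%:R^-1 * b x) * b x)).
  apply: measurable_funM => //; apply: measurable_funM => //.
  apply: measurable_dpw => //; apply: measurable_funD => //.
  exact: measurable_funM.
have mF' : measurable_fun [set: T] (fun x => K x * (dpw p (a x) * b x)).
  by apply: measurable_funM => //; apply: measurable_funM => //; exact: measurable_dpw.
have FM k x : `|K x * (dpw p (a x + k.+1%:R^-1 * b x) * b x)| <=
    M * (pw p (b x) + pw p (c x)).
  have /andP[K0 KMx] := KM x.
  rewrite normrM (ger0_norm K0); apply: ler_pM => //.
  apply: (le_trans (dpw_young p1 pq _ _)).
  apply: lerD; first by rewrite ler_divr_le ?pw_ge0.
  apply: (le_trans (ler_divr_le q1 (pw_ge0 _ _))).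
  apply: le_pw => //; rewrite (le_trans (ler_normD _ _))// lerD2l normrM.
  by rewrite ler_wpM2r// ger0_norm ?invr_ge0// invf_le1// ler1n.
pose E_ k x := (K x * (dpw p (a x + k.+1%:R^-1 * b x) * b x))%:E.
pose E x := (K x * (dpw p (a x) * b x))%:E.
have mE_ k : measurable_fun [set: T] (E_ k) by exact/measurable_EFinP.
have mE : measurable_fun [set: T] E by exact/measurable_EFinP.
have [|//|h1 _ h2] := @dominated_convergence _ _ _ mu _ measurableT E_ E
  (fun x => (M * (pw p (b x) + pw p (c x)))%:E) mE_ mE _ rg.
- apply: aeW => x _; apply: cvg_EFin; first exact: nearW.
  have hs : a x + k.+1%:R^-1 * b x @[k --> \oo] --> a x.
    rewrite -[X in _ --> X]addr0 -(mul0r (b x)).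
    apply: cvgD; first exact: cvg_cst.
    by apply: cvgM; [exact: cvg_harmonic|exact: cvg_cst].
  apply: cvgM; first exact: cvg_cst.
  apply: cvgM; last exact: cvg_cst.
  exact: (cvg_comp _ _ hs (@continuous_dpw _ p p1 (a x))).
- by apply: aeW => x k _; rewrite lee_fin.
apply: fine_cvg; move: h2; rewrite /E EFin_rint//.
Qed.

End Lp_estimates.

(** * The abstract variational problem *)

(* In the application, X is R^n, Z is R^n x R^n, Om is the domain, G u is the
   zero extension of the nonlocal gradient of u, and K is the conductivity. *)
Section abstract_problem.
Context dX (X : measurableType dX) dZ (Z : measurableType dZ) (R : realType).
Variables (mu : {measure set X -> \bar R}) (nu : {measure set Z -> \bar R}).
Variables (p q : R).
Hypotheses (p1 : 1 < p) (pq : p^-1 + q^-1 = 1).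
Variables (Om : set X) (G : (X -> R) -> Z -> R).
Variables (K : Z -> R) (klo khi Cp : R).
Hypothesis G_linear : forall u v c z,
  G (fun x => u x + c * v x) z = G u z + c * G v z.
Hypothesis G_measurable : forall u,
  measurable_fun [set: X] u -> measurable_fun [set: Z] (G u).
Hypothesis G_closed : forall (u_ : nat -> X -> R) u,
  {ae mu, forall x, u_ ^~ x @ \oo --> u x} ->
  {ae nu, forall z, G (u_ k) z @[k --> \oo] --> G u z}.
Hypothesis (klo0 : 0 < klo) (mK : measurable_fun [set: Z] K).
Hypothesis K_bounds : forall z, klo <= K z <= khi.

(** Elements of L^p(Om) are represented by their zero extensions, so that every integral runs over a
    whole space. *)
Definition admissible (u : X -> R) := [/\ forall x, ~ Om x -> u x = 0,
  u \in Lfun mu p%:E & G u \in Lfun nu p%:E].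

Hypothesis Cp0 : 0 < Cp.
Hypothesis poincare : forall u, admissible u ->
  \int[mu]_x pw p (u x) <= Cp * \int[nu]_z pw p (G u z).

Definition is_div (s : Z -> R) (g : X -> R) :=
  [/\ s \in Lfun nu q%:E, g \in Lfun mu q%:E & forall u, admissible u ->
    \int[mu]_x (g x * u x) = - \int[nu]_z (s z * G u z)].

Definition energy (u : X -> R) := \int[nu]_z (K z * pw p (G u z)).

Definition primal (f u : X -> R) := p^-1 * energy u - \int[mu]_x (f x * u x).

Definition complementary (s : Z -> R) :=
  q^-1 * \int[nu]_z (K z `^ (1 - q) * pw q (s z)).

Let p0 : 0 < p. Proof. exact: lt_trans p1. Qed.
Let q1 : 1 < q. Proof. exact: conjugate_gt1 p1 pq. Qed.
Let q0 : 0 < q. Proof. exact: lt_trans q1. Qed.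
Let K0 z : 0 < K z. Proof. by have /andP[+ _] := K_bounds z; exact: lt_le_trans. Qed.
Let K_le z : 0 <= K z <= khi.
Proof. by have /andP[_ ->] := K_bounds z; rewrite ltW. Qed.

Lemma admissibleDZ c u v : admissible u -> admissible v ->
  admissible (fun x => u x + c * v x).
Proof.
move=> [u0 up Gup] [v0 vp Gvp]; split.
- by move=> x Ox; rewrite u0// v0// mulr0 addr0.
- exact: LfunDZ.
- rewrite (_ : G _ = fun z => G u z + c * G v z); first exact: LfunDZ.
  by apply/funext => z; exact: G_linear.
Qed.

Lemma K_pw_rint s : s \in Lfun nu p%:E -> rint nu (fun z => K z * pw p (s z)).
Proof. by move=> sp; apply: bounded_mul_rint K_le _ => //; exact: Lfun_pw. Qed.

Lemma energy_lower s : s \in Lfun nu p%:E ->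
  klo * \int[nu]_z pw p (s z) <= \int[nu]_z (K z * pw p (s z)).
Proof.
move=> sp; rewrite -RintZ; last exact: Lfun_pw.
apply: le_Rint; [by apply: rintZ; exact: Lfun_pw|exact: K_pw_rint|].
by move=> z; rewrite ler_wpM2r ?pw_ge0//; case/andP: (K_bounds z).
Qed.

Lemma energy_ge0 u : 0 <= energy u.
Proof.
by apply: Rintegral_ge0 => z _; rewrite mulr_ge0 ?pw_ge0// ltW.
Qed.

Lemma poincare_energy u : admissible u ->
  klo * \int[mu]_x pw p (u x) <= Cp * energy u.
Proof.
move=> Uu; have [_ _ Gup] := Uu.
have := energy_lower Gup; rewrite -/(energy u) => h1.
have := poincare Uu; rewrite -(ler_pM2l klo0) => /le_trans; apply.
by rewrite mulrCA ler_pM2l.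
Qed.

(** Young's inequality for x k^(1/p) and s k^(-1/p); the exponent 1 - q of the conductivity is - q /
    p. *)
Lemma complementary_young k s x : 0 < k ->
  0 <= s * x + (q^-1 * (k `^ (1 - q) * pw q s) + p^-1 * (k * pw p x)).
Proof.
move=> k0; have kp0 : 0 < k `^ p^-1 by exact: powR_gt0.
have := conjugate_powR (normr_ge0 (x * k `^ p^-1)) (normr_ge0 (s / k `^ p^-1))
  p0 q0 pq.
rewrite -normrM mulrACA mulfV ?gt_eqF// mulr1.
rewrite !normrM normfV (ger0_norm (ltW kp0)) !powRM ?invr_ge0 ?(ltW kp0)//.
rewrite -powRrM mulVf ?gt_eqF// powRr1 ?(ltW k0)// -(powR_inv1 (ltW kp0)).
rewrite -!powRrM.
have -> : p^-1 * (-1 * q) = 1 - q.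
  by have -> : p^-1 = 1 - q^-1 by [rewrite -pq addrK]; field; rewrite gt_eqF.
move=> h; have := ler_norm (- (s * x)); rewrite normrN normrM [`|s| * _]mulrC.
move=> /le_trans /(_ h); rewrite -subr_ge0 opprK addrC; congr (_ <= _).
by rewrite /pw; ring.
Qed.

Lemma complementary_rint s : s \in Lfun nu q%:E ->
  rint nu (fun z => K z `^ (1 - q) * pw q (s z)).
Proof.
(* As 1 - q < 0, it is the lower bound [klo] that bounds the weight from above. *)
move=> sq; apply: (@bounded_mul_rint _ _ _ _ _ (klo `^ (1 - q))).
- exact: (measurableT_comp (measurable_powR _)).
- move=> z; rewrite powR_ge0/= -opprB !powRN lef_pV2 ?posrE ?powR_gt0//.
  have /andP[kK _] := K_bounds z.
  by apply: ge0_ler_powR; rewrite ?nnegrE ?(ltW (K0 z)) ?(ltW klo0)// subr_ge0 ltW.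
- exact: Lfun_pw.
Qed.

Lemma weak_duality f u s g : f \in Lfun mu q%:E -> admissible u -> is_div s g ->
  - primal f u <= complementary s + \int[mu]_x ((f x - g x) * u x).
Proof.
move=> fq Uu [sq gq /(_ _ Uu) sg]; have [_ up Gup] := Uu.
have -> : \int[mu]_x ((f x - g x) * u x) =
    \int[mu]_x (f x * u x) + \int[nu]_z (s z * G u z).
  rewrite -[X in _ + X]opprK -sg -RintB; [|exact: (Lfun_mulr p1 pq)..].
  by apply: eq_Rint => x; rewrite mulrBl.
rewrite /primal opprB -subr_ge0.
have rs := complementary_rint sq; have rG := K_pw_rint Gup.
have rsG : rint nu (fun z => s z * G u z) by exact: (Lfun_mulr p1 pq).
have : 0 <= \int[nu]_z (s z * G u z +
    (q^-1 * (K z `^ (1 - q) * pw q (s z)) + p^-1 * (K z * pw p (G u z)))).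
  by apply: Rintegral_ge0 => z _; exact: complementary_young.
rewrite RintD//; last by apply: rintD; exact: rintZ.
rewrite RintD; [|exact: rintZ..].
rewrite !RintZ// -/(energy u) -/(complementary s).
by move=> /le_trans; apply; apply: eq_ler; ring.
Qed.

(** * The proximal problems and their Euler-Lagrange equations *)

Section proximal.
Variables (t : R) (h f : X -> R).
Hypotheses (t0 : 0 <= t) (hp : h \in Lfun mu p%:E) (fq : f \in Lfun mu q%:E).

Definition dist (u : X -> R) := \int[mu]_x pw p (u x - h x).

Definition functional u := primal f u + t / p * dist u.

Definition mid (u v : X -> R) x := (u x + v x) / 2.

Lemma midE u v : mid u v = fun x => u x + 2^-1 * (v x + (-1) * u x).
Proof. by apply/funext => x; rewrite /mid; field. Qed.

Lemma G_mid u v z : G (mid u v) z = (G u z + G v z) / 2.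
Proof.
by rewrite midE G_linear (G_linear v u); field.
Qed.

Lemma admissible_mid u v : admissible u -> admissible v -> admissible (mid u v).
Proof.
by move=> Uu Uv; rewrite midE; apply: admissibleDZ => //; exact: admissibleDZ.
Qed.

Lemma dist_mid u v : u \in Lfun mu p%:E -> v \in Lfun mu p%:E ->
  dist (mid u v) <= (dist u + dist v) / 2.
Proof.
move=> up vp; rewrite /dist.
have ru := Lfun_pw p1 (LfunB p1 up hp); have rv := Lfun_pw p1 (LfunB p1 vp hp).
have mp : mid u v \in Lfun mu p%:E.
  rewrite midE; do 2 apply: (LfunDZ p1) => //.
rewrite -RintD// mulrC -RintZ; last exact: rintD.
apply: le_Rint; [exact: (Lfun_pw p1 (LfunB p1 mp hp))|by apply: rintZ; exact: rintD|].
move=> x; rewrite mulrC; apply: le_trans (pw_midpoint p1 pq _ _).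
by apply: eq_ler; congr (pw p _); rewrite /mid; field.
Qed.

Lemma linear_mid u v : u \in Lfun mu p%:E -> v \in Lfun mu p%:E ->
  \int[mu]_x (f x * mid u v x) =
  (\int[mu]_x (f x * u x) + \int[mu]_x (f x * v x)) / 2.
Proof.
move=> up vp; rewrite -RintD; [|exact: (Lfun_mulr p1 pq)..].
rewrite mulrC -RintZ; last by apply: rintD; exact: (Lfun_mulr p1 pq).
by apply: eq_Rint => x; rewrite /mid; field.
Qed.

(** The energy alone contributes: the midpoint gap of the linear form vanishes and that of [dist] is
    nonnegative. The factor p in the constant undoes the 1 / p in [primal]. *)
Lemma functional_uniform_convexity e : 0 < e -> exists2 c, 0 < c & forall u v,
  admissible u -> admissible v ->
  klo * \int[nu]_z pw p (G u z - G v z) <= e * (energy u + energy v) +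
   c * ((functional u + functional v) / 2 - functional (mid u v)).
Proof.
move=> e0; have [C C0 hC] := pw_uniform_convexity p1 pq e0.
exists (C * p); first by rewrite mulr_gt0.
move=> u v Uu Uv.
have [_ up Gup] := Uu; have [_ vp Gvp] := Uv.
have [_ mp Gmp] := admissible_mid Uu Uv.
have dp : (fun z => G u z - G v z) \in Lfun nu p%:E by exact: LfunB.
apply: (le_trans (energy_lower dp)).
have rs : rint nu (fun z => K z * pw p (G u z) + K z * pw p (G v z)).
  by apply: rintD; exact: K_pw_rint.
have rm : rint nu (fun z => K z * pw p (G (mid u v) z)) by exact: K_pw_rint.
have step : \int[nu]_z (K z * pw p (G u z - G v z)) <=
    e * (energy u + energy v) +
    C * ((energy u + energy v) / 2 - energy (mid u v)).
  rewrite /energy -RintD; [|exact: K_pw_rint..].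
  rewrite [X in C * (X - _)]mulrC -!RintZ// -RintB//; last exact: rintZ.
  rewrite -RintZ; last by apply: rintB => //; exact: rintZ.
  rewrite -RintD; last 2 first.
  - exact: rintZ.
  - by apply: rintZ; apply: rintB => //; exact: rintZ.
  apply: le_Rint; first exact: K_pw_rint.
    apply: rintD; first exact: rintZ.
    by apply: rintZ; apply: rintB => //; exact: rintZ.
  move=> z; rewrite G_mid.
  have := hC (G u z) (G v z); rewrite -(ler_pM2l (K0 z)) => /le_trans; apply.
  by apply: eq_ler; field.
apply: (le_trans step); rewrite lerD2l -mulrA ler_pM2l//.
have hd := dist_mid up vp.
rewrite /functional /primal linear_mid//.
have : 0 <= t * ((dist u + dist v) / 2 - dist (mid u v)).
  by rewrite mulr_ge0// subr_ge0.
rewrite le_eqVlt => ht.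
set a := energy u; set b := energy v; set m := energy _.
set L := \int[mu]_x _; set L' := \int[mu]_x _; set D := dist (mid u v).
have -> : p * ((p^-1 * a - L + t / p * dist u + (p^-1 * b - L' + t / p * dist v)) / 2
  - (p^-1 * m - (L + L') / 2 + t / p * D)) =
  (a + b) / 2 - m + t * ((dist u + dist v) / 2 - D).
  move: a b m L L' D (dist u) (dist v) => {step ht hd} a b m L L' D du dv.
  by field; rewrite gt_eqF.
by rewrite lerDl le_eqVlt.
Qed.

Lemma functional_coercive : exists c, forall u, admissible u ->
  energy u <= 2 * p * (functional u + c).
Proof.
(* With this [e], Poincare's inequality bounds the linear form by energy / (2 p) plus a constant,
   which absorbs half of the energy term. *)
pose e := klo / (2 * p * Cp).
have e0 : 0 < e by rewrite divr_gt0// !mulr_gt0.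
have [c hc] := linear_form_coercive p1 pq e0 fq; exists c => u Uu.
have [_ up _] := Uu.
have h1 := hc _ up; have h2 := poincare_energy Uu.
have d0 : 0 <= t / p * dist u.
  by rewrite mulr_ge0 ?divr_ge0 ?(ltW p0)//; apply: Rintegral_ge0 => x _; exact: pw_ge0.
have h3 : e * \int[mu]_x pw p (u x) <= energy u / (2 * p).
  rewrite /e mulrAC ler_pdivrMr ?mulr_gt0//.
  apply: (le_trans h2); apply: eq_ler.
  by field; rewrite gt_eqF.
rewrite /functional /primal mulrC -ler_pdivrMr ?mulr_gt0//.
have -> : energy u / (2 * p) = p^-1 * energy u - energy u / (2 * p).
  by field; rewrite gt_eqF.
move: (\int[mu]_x (f x * u x)) h1 h3 d0 => L.
move: (t / p * dist u) (p^-1 * energy u) (energy u / (2 * p)) (e * _).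
by move=> a b b' d {h2}; lra.
Qed.

(* Uniform convexity controls the gradients, and Poincare's inequality the
   functions. *)
Lemma minimizing_cauchy m r : 0 < r ->
  (forall u, admissible u -> m <= functional u) ->
  exists2 e, 0 < e & forall u v, admissible u -> admissible v ->
    functional u < m + e -> functional v < m + e ->
    \int[mu]_x pw p (u x - v x) <= r.
Proof.
move=> r0 hm; have [c hc] := functional_coercive.
(* [M] bounds the energy of all competitors whose value is within [eta] <= 1 of [m]. The target,
   rescaled to [rho], is split in two: e (M + M) = rho / 2, and C times the midpoint gap is at most
   C eta <= rho / 2. *)
pose M := `|2 * p * (m + 1 + c)| + 1.
have M0 : 0 < M by rewrite ltr_wpDl.
pose rho := r * klo / Cp.
have rho0 : 0 < rho by rewrite divr_gt0// mulr_gt0.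
pose e := rho / (4 * M).
have e0 : 0 < e by rewrite divr_gt0// mulr_gt0.
have [C C0 hC] := functional_uniform_convexity e0.
pose eta := Num.min 1 (rho / (2 * C)).
have eta0 : 0 < eta by rewrite lt_min ltr01 divr_gt0// mulr_gt0.
have eta1 : eta <= 1 by rewrite ge_min lexx.
have eta2 : eta <= rho / (2 * C) by rewrite ge_min lexx orbT.
exists eta => // u v Uu Uv uM vM.
have bound w : admissible w -> functional w < m + eta -> energy w <= M.
  move=> Uw wM; apply: (le_trans (hc _ Uw)); rewrite /M.
  apply: (@le_trans _ _ (2 * p * (m + 1 + c))).
    rewrite ler_pM2l ?mulr_gt0// lerD2r.
    by rewrite (le_trans (ltW wM))// lerD2l.
  by rewrite (le_trans (ler_norm _))// lerDl.
have Uw : admissible (fun x => u x + (-1) * v x) by exact: admissibleDZ.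
have /le_trans -> // : \int[mu]_x pw p (u x - v x) <=
    Cp * \int[nu]_z pw p (G u z - G v z).
  have := poincare Uw.
  under eq_Rintegral do rewrite mulN1r.
  under [X in _ <= _ * X]eq_Rintegral do rewrite G_linear mulN1r.
  by [].
rewrite -ler_pdivlMl// -(ler_pM2l klo0).
apply: (le_trans (hC _ _ Uu Uv)).
have -> : klo * (Cp^-1 * r) = rho / 2 + rho / 2.
  by rewrite /rho; field; rewrite gt_eqF.
apply: lerD.
  apply: (@le_trans _ _ (e * (M + M))).
    by rewrite ler_pM2l// lerD// bound.
  by rewrite /e le_eqVlt; apply/orP; left; apply/eqP; field; rewrite gt_eqF.
rewrite mulrC -ler_pdivlMr//.
have hmid := hm _ (admissible_mid Uu Uv).
have : rho / 2 / C = rho / (2 * C) by field; rewrite gt_eqF.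
move=> ->; move: hmid uM vM eta2 => {bound hC hc Uw}.
move: (functional u) (functional v) (functional _) (rho / (2 * C)).
by move=> a b c' d; lra.
Qed.

(** Fatou's lemma handles the energy and [dist]. The linear form has no sign, and passes to the
    limit by L^p convergence instead. *)
Lemma functional_lsc (u_ : nat -> X -> R) u m :
  (forall k, admissible (u_ k)) -> admissible u ->
  {ae mu, forall x, u_ ^~ x @ \oo --> u x} ->
  (forall e, 0 < e -> \forall k \near \oo,
    \int[mu]_x pw p (u_ k x - u x) <= e) ->
  (forall e, 0 < e -> \forall k \near \oo, functional (u_ k) < m + e) ->
  functional u <= m.
Proof.
move=> Uu_ Uu u_u uLp uPhi; apply/ler_addgt0Pr => e e0.
have [_ up Gup] := Uu.
have up_ k : u_ k \in Lfun mu p%:E by have [] := Uu_ k.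
have Gup_ k : G (u_ k) \in Lfun nu p%:E by have [] := Uu_ k.
have cpw := @continuous_pw _ p p1.
(* The losses are e' / p in the energy, (t / p) e' in [dist], 2 e' in the linear form, and e' in the
   value of the functional at [u_ k]. *)
pose e' := e / (p^-1 + t / p + 3).
have tp0 : 0 <= t / p by rewrite divr_ge0// ltW.
have ip0 : 0 < p^-1 by rewrite invr_gt0.
have s0 : 0 < p^-1 + t / p + 3 by rewrite addr_gt0// ltr_pwDl.
have e'0 : 0 < e' by rewrite divr_gt0.
have [c c0 hc] := linear_form_continuous p1 pq e'0 fq.
have ec0 : 0 < e' / c by rewrite divr_gt0.
near \oo => k.
have h1 : energy u - e' <= energy (u_ k).
  near: k; apply: fatou_near => //.
  - by move=> k; exact: K_pw_rint.
  - by move=> k z; rewrite mulr_ge0 ?pw_ge0// ltW.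
  - exact: K_pw_rint.
  - by move=> z; rewrite mulr_ge0 ?pw_ge0// ltW.
  - apply: filterS (G_closed u_u) => z hz; apply: cvgM; first exact: cvg_cst.
    exact: (cvg_comp _ _ hz (cpw _)).
have h2 : dist u - e' <= dist (u_ k).
  near: k; apply: fatou_near => //.
  - by move=> k; apply: Lfun_pw => //; exact: LfunB.
  - by move=> k z; exact: pw_ge0.
  - by apply: Lfun_pw => //; exact: LfunB.
  - by move=> z; exact: pw_ge0.
  - apply: filterS u_u => x hx.
    have hx' : u_ n x - h x @[n --> \oo] --> u x - h x.
      by apply: cvgB => //; exact: cvg_cst.
    exact: (cvg_comp _ _ hx' (cpw _)).
have h3 : \int[mu]_x (f x * u_ k x) <= \int[mu]_x (f x * u x) + 2 * e'.
  have dp : (fun x => u_ k x - u x) \in Lfun mu p%:E by exact: LfunB.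
  have := hc _ dp.
  have -> : \int[mu]_x (f x * (u_ k x - u x)) =
      \int[mu]_x (f x * u_ k x) - \int[mu]_x (f x * u x).
    rewrite -RintB; [|exact: (Lfun_mulr p1 pq)..].
    by apply: eq_Rint => x; rewrite mulrBr.
  have : \int[mu]_x pw p (u_ k x - u x) <= e' / c by near: k; exact: uLp.
  rewrite -(ler_pM2l c0) mulrCA mulfV ?gt_eqF// mulr1.
  move: (\int[mu]_x (f x * u_ k x)) (\int[mu]_x (f x * u x)) => a b.
  by move: (c * _) => d {h1 h2}; lra.
have h4 : functional (u_ k) < m + e' by near: k; exact: uPhi.
have -> : e = p^-1 * e' + t / p * e' + 3 * e'.
  by rewrite -!mulrDl /e' mulrC divfK// gt_eqF.
move: h4; rewrite /functional /primal.
have : p^-1 * (energy u - e') <= p^-1 * energy (u_ k) by rewrite ler_pM2l.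
have : t / p * (dist u - e') <= t / p * dist (u_ k) by rewrite ler_wpM2l.
move: (\int[mu]_x (f x * u_ k x)) (\int[mu]_x (f x * u x)) h3 => a b.
move: (t / p) (p^-1) (dist u) (dist _) (energy u) (energy _) => x y z w z' w'.
rewrite !mulrBr => {h1 h2}; lra.
Unshelve. all: by end_near. Qed.

Lemma G0 : G (fun=> 0) = fun=> 0.
Proof.
apply/funext => z; transitivity (G (fun=> 0 + (-1) * 0) z).
  by congr (G _ z); apply/funext => x; rewrite mulr0 addr0.
by rewrite G_linear mulN1r subrr.
Qed.

Lemma admissible0 : admissible (fun=> 0).
Proof.
have pz : pw p (0 : R) = 0 by exact: pw0.
by split=> //; rewrite ?G0; apply: pw_Lfun => //; rewrite pz integral0 ltry.
Qed.

(** Fatou's lemma bounds the energy of the limit, and K >= klo turns a finite energy into G u in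
    L^p. This serves both the minimising sequence and the proximal minimisers in [dual_bound]. *)
Lemma admissible_limit (u_ : nat -> X -> R) u M :
  (forall k, admissible (u_ k)) -> (forall k, energy (u_ k) <= M) ->
  measurable_fun [set: X] u -> u \in Lfun mu p%:E ->
  (forall x, ~ Om x -> u x = 0) ->
  {ae mu, forall x, u_ ^~ x @ \oo --> u x} ->
  admissible u /\ energy u <= M.
Proof.
move=> Uu_ uM mu_u up u0 u_u.
have Gup_ k : G (u_ k) \in Lfun nu p%:E by have [] := Uu_ k.
have mGu := G_measurable mu_u.
have cpw := @continuous_pw _ p p1.
have KGu : (\int[nu]_z (K z * pw p (G u z))%:E <= M%:E)%E.
  apply: (@fatou_le _ _ _ nu (fun k z => K z * pw p (G (u_ k) z))).
  - move=> k; apply: measurable_funM => //; apply: measurable_pw.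
    exact: (Lfun_measurable (Gup_ k)).
  - by move=> k z; rewrite mulr_ge0 ?pw_ge0// ltW.
  - by apply: measurable_funM => //; exact: measurable_pw.
  - by move=> z; rewrite mulr_ge0 ?pw_ge0// ltW.
  - apply: filterS (G_closed u_u) => z hz; apply: cvgM; first exact: cvg_cst.
    exact: (cvg_comp _ _ hz (cpw _)).
  - by apply: nearW => k; rewrite EFin_rint ?lee_fin; [exact: uM|exact: K_pw_rint].
have rK : rint nu (fun z => K z * pw p (G u z)).
  apply: ge0_rint KGu; first by apply: measurable_funM => //; exact: measurable_pw.
  by move=> z; rewrite mulr_ge0 ?pw_ge0// ltW.
have Gup : G u \in Lfun nu p%:E.
  apply: pw_Lfun => //; rewrite EFin_rint ?ltry//.
  apply: (@rint_le _ _ _ _ _ (fun z => klo^-1 * (K z * pw p (G u z)))).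
  - exact: measurable_pw.
  - exact: rintZ.
  - move=> z; rewrite ger0_norm ?pw_ge0// mulrA ler_peMl ?pw_ge0//.
    by rewrite ler_pdivlMl// mulr1; case/andP: (K_bounds z).
split; first by split.
by rewrite -lee_fin -EFin_rint.
Qed.

Lemma functional_minimizer :
  exists2 u, admissible u & forall v, admissible v -> functional u <= functional v.
Proof.
have [c hc] := functional_coercive.
pose S := [set functional u | u in admissible].
have S0 : S !=set0 by exists (functional (fun=> 0)); exists (fun=> 0) => //; exact: admissible0.
have Slb : lbound S (- c).
  move=> _ [u Uu <-]; have := le_trans (energy_ge0 u) (hc _ Uu).
  by rewrite pmulr_rge0 ?mulr_gt0// -lerBlDr sub0r.
have Sinf : has_inf S by split => //; exists (- c).
pose m := inf S.
have mS u : admissible u -> m <= functional u.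
  by move=> Uu; apply: ge_inf; [exists (- c)|exists u].
(* The divisor (2^k)^p compensates the factor 2^k in [ae_is_cvg] and leaves the summable bound
   2^-(k+1). *)
pose r k : R := (1 / (2 ^ (k + 1))%:R) / (2 ^+ k) `^ p.
have r0 k : 0 < r k.
  by rewrite !divr_gt0// ?powR_gt0 ?exprn_gt0// ltr0n expn_gt0.
have rle k : r k <= k.+1%:R^-1.
  rewrite /r mul1r.
  apply: (@le_trans _ _ (2 ^ (k + 1))%:R^-1).
    rewrite ler_pdivrMr ?powR_gt0 ?exprn_gt0// ler_peMr//.
    rewrite -[leLHS](powRr0 (2 ^+ k)) ler_powR ?exprn_ege1 ?ler1n//.
    exact: ltW.
  rewrite lef_pV2 ?posrE ?ltr0n ?expn_gt0// ler_nat addn1.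
  exact: ltnW (ltn_expl _ _).
have [eta heta] : {eta : nat -> R & forall k, 0 < eta k /\
    forall u v, admissible u -> admissible v ->
    functional u < m + eta k -> functional v < m + eta k ->
    \int[mu]_x pw p (u x - v x) <= r k}.
  apply: (@choice _ _ (fun k e => 0 < e /\ forall u v, admissible u -> admissible v ->
    functional u < m + e -> functional v < m + e ->
    \int[mu]_x pw p (u x - v x) <= r k)) => k.
  by have [e e0 he] := minimizing_cauchy (r0 k) mS; exists e.
(* The [eta k] need not decrease, so the k-th tolerance lies below all earlier ones: then [u_ j] and
   [u_ k] both qualify for [eta k] whenever k <= j. The bounds 1 / (j + 1) make the sequence
   minimising. *)
have eta_min k : exists2 e, 0 < e & forall j, (j <= k)%N -> e <= eta j /\ e <= j.+1%:R^-1.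
  elim: k => [|k [e e0 he]].
    exists (Num.min (eta 0%N) 1).
      by rewrite lt_min ltr01 andbT; have [] := heta 0%N.
    by move=> j; rewrite leqn0 => /eqP ->; rewrite !ge_min invr1 !lexx orbT.
  exists (Num.min e (Num.min (eta k.+1) k.+2%:R^-1)).
    by rewrite !lt_min e0 invr_gt0 ltr0n /= andbT; have [] := heta k.+1.
  move=> j; rewrite leq_eqVlt => /predU1P[->|].
    by rewrite !ge_min !lexx !orbT.
  by rewrite ltnS => /he[h1 h2]; rewrite !ge_min h1 h2.
have [u_ hu_] : {u_ : nat -> X -> R & forall k, admissible (u_ k) /\
    forall j, (j <= k)%N -> functional (u_ k) < m + eta j /\
      functional (u_ k) < m + j.+1%:R^-1}.
  apply: (@choice _ _ (fun k u => admissible u /\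
    forall j, (j <= k)%N -> functional u < m + eta j /\
      functional u < m + j.+1%:R^-1)) => k.
  have [e e0 he] := eta_min k.
  have [_ [u Uu <-] um] := inf_adherent e0 Sinf.
  exists u; split => // j /he[h1 h2].
  by split; apply: (lt_le_trans um); rewrite lerD2l.
have Uu_ k : admissible (u_ k) by have [] := hu_ k.
have up_ k : u_ k \in Lfun mu p%:E by have [] := Uu_ k.
have mu_ k : measurable_fun [set: X] (u_ k) by exact: Lfun_measurable (up_ k).
have cpw := @continuous_pw _ p p1.
have cauchy j k : (k <= j)%N -> \int[mu]_x pw p (u_ j x - u_ k x) <= r k.
  move=> kj; have [_ etak] := heta k; apply: etak => //.
    by have [_ /(_ _ kj) []] := hu_ j.
  by have [_ /(_ _ (leqnn k)) []] := hu_ k.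
have cvu : {ae mu, forall x, cvgn (u_ ^~ x)}.
  apply: (@ae_is_cvg _ _ _ _ p) => // k.
  have dp : (fun x => u_ k.+1 x - u_ k x) \in Lfun mu p%:E by exact: LfunB.
  under eq_integral do rewrite pwM.
  rewrite EFin_rint; last by apply: rintZ; exact: Lfun_pw.
  rewrite RintZ; last exact: Lfun_pw.
  have := cauchy k.+1 k (leqnSn k).
  rewrite lee_fin /r ler_pdivlMr ?powR_gt0 ?exprn_gt0// mulrC.
  by rewrite /pw (ger0_norm (exprn_ge0 _ _)).
have [u [mu_u u_u u0]] := ae_cvg_measurable mu_ cvu.
pose M := `|2 * p * (m + 1 + c)|.
have Mu k : energy (u_ k) <= M.
  apply: (le_trans (hc _ (Uu_ k))); apply: le_trans (ler_norm _).
  rewrite ler_pM2l ?mulr_gt0//.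
  have [_ /(_ 0%N isT)[_]] := hu_ k; rewrite invr1; lra.
have up : u \in Lfun mu p%:E.
  apply: pw_Lfun => //; apply: (@le_lt_trans _ _ (Cp * M / klo)%:E); last exact: ltry.
  apply: (@fatou_le _ _ _ mu (fun k x => pw p (u_ k x))).
  - by move=> k; exact: measurable_pw.
  - by move=> k x; exact: pw_ge0.
  - exact: measurable_pw.
  - by move=> x; exact: pw_ge0.
  - by apply: filterS u_u => x hx; exact: (cvg_comp _ _ hx (cpw _)).
  - apply: nearW => k; rewrite EFin_rint ?lee_fin; last exact: Lfun_pw.
    rewrite ler_pdivlMr// mulrC (le_trans (poincare_energy (Uu_ k)))//.
    by rewrite ler_pM2l.
have uOm x : ~ Om x -> u x = 0 by move=> Ox; apply: u0 => k; have [->] := Uu_ k.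
have [Uu _] := admissible_limit Uu_ Mu mu_u up uOm u_u.
exists u; first exact: Uu.
move=> v Uv; apply: le_trans (mS _ Uv).
apply: (functional_lsc Uu_ Uu u_u).
- move=> e e0; near=> k.
  apply: (@le_trans _ _ (r k)).
    have dp : (fun x => u_ k x - u x) \in Lfun mu p%:E by exact: LfunB.
    rewrite -lee_fin -EFin_rint; last exact: Lfun_pw.
    (* Fatou's lemma in j, with k fixed, carries the Cauchy bound to the limit and so gives L^p
       convergence. *)
    apply: (@fatou_le _ _ _ mu (fun j x => pw p (u_ k x - u_ j x))).
    + by move=> j; apply: measurable_pw; exact: measurable_funB.
    + by move=> j x; exact: pw_ge0.
    + by apply: measurable_pw; exact: measurable_funB.
    + by move=> x; exact: pw_ge0.
    + apply: filterS u_u => x hx.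
      have hx' : u_ k x - u_ j x @[j --> \oo] --> u_ k x - u x.
        by apply: cvgB => //; exact: cvg_cst.
      exact: (cvg_comp _ _ hx' (cpw _)).
    + exists k => // j /= kj; rewrite EFin_rint; last first.
        by apply: Lfun_pw => //; exact: LfunB.
      rewrite lee_fin; under eq_Rintegral do rewrite -pwN opprB.
      exact: cauchy.
  apply: (le_trans (rle k)); apply: ltW.
  by near: k; exact: near_infty_natSinv_lt (PosNum e0).
- move=> e e0; near=> k.
  have [_ /(_ k (leqnn k))[_ /lt_trans]] := hu_ k; apply.
  rewrite ltrD2l.
  by near: k; exact: near_infty_natSinv_lt (PosNum e0).
Unshelve. all: by end_near. Qed.

(* The tangent inequality at u + s v bounds the difference quotient of the
   functional by the first variation at u + s v; then s tends to 0. *)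
Lemma variation_ge0 u v : admissible u -> admissible v ->
  (forall w, admissible w -> functional u <= functional w) ->
  0 <= \int[nu]_z (K z * (dpw p (G u z) * G v z)) +
       t * \int[mu]_x (1 * (dpw p (u x - h x) * v x)) -
       \int[mu]_x (f x * v x).
Proof.
move=> Uu Uv umin.
have arith (x x' y y' a b l l' : R) : x - a <= x' -> y - b <= y' ->
  x' - l' + y' <= x - (l' + l) + y -> 0 <= a + b - l by lra.
have [_ up Gup] := Uu; have [_ vp Gvp] := Uv.
have uhp : (fun x => u x - h x) \in Lfun mu p%:E by exact: LfunB.
have cG := cvg_int_dpw p1 pq mK K_le Gup Gvp.
have c1 : \int[mu]_x (1 * (dpw p (u x - h x + k.+1%:R^-1 * v x) * v x))
    @[k --> \oo] --> \int[mu]_x (1 * (dpw p (u x - h x) * v x)).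
  apply: (@cvg_int_dpw _ _ _ mu p q p1 pq (cst 1) 1 _ _ _ _ uhp vp) => // x.
  by rewrite /= ler01 lexx.
pose Q k := \int[nu]_z (K z * (dpw p (G u z + k.+1%:R^-1 * G v z) * G v z)) +
  t * \int[mu]_x (1 * (dpw p (u x - h x + k.+1%:R^-1 * v x) * v x)) -
  \int[mu]_x (f x * v x).
have cQ : Q k @[k --> \oo] -->
    \int[nu]_z (K z * (dpw p (G u z) * G v z)) +
    t * \int[mu]_x (1 * (dpw p (u x - h x) * v x)) - \int[mu]_x (f x * v x).
  apply: cvgB; last exact: cvg_cst.
  by apply: cvgD => //; apply: cvgM => //; exact: cvg_cst.
rewrite -(cvg_lim _ cQ)//; apply: limr_ge; first by apply/cvg_ex; eexists; exact: cQ.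
apply: nearW => k; rewrite /Q; set s : R := k.+1%:R^-1.
have s0 : 0 < s by rewrite invr_gt0.
pose w x := u x + s * v x.
have Uw : admissible w by exact: admissibleDZ.
have [_ wp Gwp] := Uw.
have Gw z : G w z = G u z + s * G v z by exact: G_linear.
have dGw : rint nu (fun z => K z * (dpw p (G w z) * G v z)).
  apply: bounded_mul_rint K_le _ => //; apply: (Lfun_mulr p1 pq) => //.
  exact: dpw_Lfun.
have whp : (fun x => w x - h x) \in Lfun mu p%:E by exact: LfunB.
have dw : rint mu (fun x => 1 * (dpw p (w x - h x) * v x)).
  by apply: rintZ; apply: (Lfun_mulr p1 pq) => //; exact: dpw_Lfun.
have h1 : energy w - s * p * \int[nu]_z (K z * (dpw p (G w z) * G v z)) <= energy u.
  rewrite /energy -RintZ// -RintB; [|exact: K_pw_rint|exact: rintZ].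
  apply: le_Rint; [|exact: K_pw_rint|].
    by apply: rintB; [exact: K_pw_rint|exact: rintZ].
  move=> z; have := pw_tangent p1 pq (G w z) (G u z).
  rewrite -(ler_pM2l (K0 z)); apply: le_trans.
  by apply: eq_ler; rewrite Gw; ring.
have h2 : dist w - s * p * \int[mu]_x (1 * (dpw p (w x - h x) * v x)) <= dist u.
  rewrite /dist -RintZ// -RintB; [|exact: Lfun_pw|exact: rintZ].
  apply: le_Rint; [|exact: Lfun_pw|].
    by apply: rintB; [exact: Lfun_pw|exact: rintZ].
  move=> x; have := pw_tangent p1 pq (w x - h x) (u x - h x).
  apply: le_trans.
  by apply: eq_ler; rewrite /w; ring.
have h3 : \int[mu]_x (f x * w x) =
    \int[mu]_x (f x * u x) + s * \int[mu]_x (f x * v x).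
  rewrite -RintZ; last exact: (Lfun_mulr p1 pq).
  rewrite -RintD; [|exact: (Lfun_mulr p1 pq)|apply: rintZ; exact: (Lfun_mulr p1 pq)].
  by apply: eq_Rint => x; rewrite /w; ring.
have := umin _ Uw; rewrite /functional /primal h3.
have -> : \int[nu]_z (K z * (dpw p (G u z + s * G v z) * G v z)) =
    \int[nu]_z (K z * (dpw p (G w z) * G v z)).
  by apply: eq_Rint => z; rewrite Gw.
have -> : \int[mu]_x (1 * (dpw p (u x - h x + s * v x) * v x)) =
    \int[mu]_x (1 * (dpw p (w x - h x) * v x)).
  by apply: eq_Rint => x; rewrite /w addrAC.
set A := \int[nu]_z _; set B := \int[mu]_x (1 * _); set L := \int[mu]_x (f x * v x).
move: (\int[mu]_x (f x * u x)) => L'.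
move=> hmin; rewrite -(pmulr_rge0 _ s0).
have h1' : p^-1 * (energy w - s * p * A) <= p^-1 * energy u.
  by rewrite ler_pM2l ?invr_gt0.
have h2' : t / p * (dist w - s * p * B) <= t / p * dist u.
  by rewrite ler_wpM2l ?divr_ge0// ltW.
have e1 : p^-1 * (energy w - s * p * A) = p^-1 * energy w - s * A.
  by field; rewrite gt_eqF.
have e2 : t / p * (dist w - s * p * B) = t / p * dist w - s * (t * B).
  by field; rewrite gt_eqF.
rewrite e1 in h1'; rewrite e2 in h2'.
by rewrite mulrBr mulrDr; exact: arith h1' h2' hmin.
Qed.

Lemma proximal_solution : exists2 u, admissible u &
  is_div (fun z => - (K z * dpw p (G u z))) (fun x => f x - t * dpw p (u x - h x)) /\
  forall v, admissible v -> functional u <= functional v.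
Proof.
have [u Uu umin] := functional_minimizer; exists u => //; split => //.
have [_ up Gup] := Uu.
have uhp : (fun x => u x - h x) \in Lfun mu p%:E by exact: LfunB.
have du := dpw_Lfun p1 pq uhp; have dG := dpw_Lfun p1 pq Gup.
split.
- have mdG := Lfun_measurable dG.
  have mKdG : measurable_fun [set: Z] (fun z => K z * dpw p (G u z)).
    exact: measurable_funM.
  apply: pw_Lfun; first exact: measurableT_comp.
  apply: (@le_lt_trans _ _ (\int[nu]_z (`|khi| `^ q * pw p (G u z))%:E)%E).
    apply: ge0_le_integral => //.
    + by move=> z _; rewrite lee_fin pw_ge0.
    + by apply/measurable_EFinP; apply: measurable_pw; exact: measurableT_comp.
    + apply/measurable_EFinP; apply: measurable_funM => //.
      by apply: measurable_pw; exact: Lfun_measurable Gup.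
    move=> z _; rewrite lee_fin pwN pwM -(dpw_conjugate p1 pq (G u z)).
    rewrite ler_wpM2r ?powR_ge0// -/(pw q khi) le_pw//.
    by have /andP[K1 K2] := K_le z; rewrite ger0_norm// (le_trans K2)// ler_norm.
  by rewrite EFin_rint ?ltry//; apply: rintZ; exact: Lfun_pw.
- rewrite (_ : (fun _ => _) = fun x => f x + (- t) * dpw p (u x - h x)).
    exact: LfunDZ.
  by apply/funext => x; rewrite mulNr.
move=> v Uv; have [_ vp Gvp] := Uv.
have := variation_ge0 Uu Uv umin.
(* The directions v and - v give opposite inequalities, hence the equation; - v is written in the
   shape of [admissibleDZ]. *)
have UNv : admissible (fun x => 0 + (-1) * v x).
  by apply: admissibleDZ => //; exact: admissible0.
have := variation_ge0 Uu UNv umin.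
have rG : rint nu (fun z => K z * (dpw p (G u z) * G v z)).
  by apply: bounded_mul_rint K_le _ => //; exact: (Lfun_mulr p1 pq).
have rd : rint mu (fun x => dpw p (u x - h x) * v x) by exact: (Lfun_mulr p1 pq).
have rf : rint mu (fun x => f x * v x) by exact: (Lfun_mulr p1 pq).
have GN z : G (fun x => 0 + (-1) * v x) z = - G v z.
  by rewrite (G_linear (fun=> 0)) G0 add0r mulN1r.
have -> : \int[nu]_z (K z * (dpw p (G u z) * G (fun x => 0 + -1 * v x) z)) =
    (-1) * \int[nu]_z (K z * (dpw p (G u z) * G v z)).
  by rewrite -RintZ//; apply: eq_Rint => z; rewrite GN; ring.
have -> : \int[mu]_x (1 * (dpw p (u x - h x) * (0 + -1 * v x))) =
    (-1) * \int[mu]_x (dpw p (u x - h x) * v x).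
  by rewrite -RintZ//; apply: eq_Rint => x; ring.
have -> : \int[mu]_x (f x * (0 + -1 * v x)) = (-1) * \int[mu]_x (f x * v x).
  by rewrite -RintZ//; apply: eq_Rint => x; ring.
have -> : \int[mu]_x (1 * (dpw p (u x - h x) * v x)) =
    \int[mu]_x (dpw p (u x - h x) * v x).
  by apply: eq_Rint => x; rewrite mul1r.
have -> : \int[mu]_x ((f x - t * dpw p (u x - h x)) * v x) =
    \int[mu]_x (f x * v x) - t * \int[mu]_x (dpw p (u x - h x) * v x).
  rewrite -RintZ// -RintB//; last exact: rintZ.
  by apply: eq_Rint => x; ring.
have -> : \int[nu]_z (- (K z * dpw p (G u z)) * G v z) =
    (-1) * \int[nu]_z (K z * (dpw p (G u z) * G v z)).
  by rewrite -RintZ//; apply: eq_Rint => z; ring.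
move=> hN hP; apply/eqP; rewrite eq_le; apply/andP; split; lra.
Qed.

End proximal.

(** * Strong duality, uniqueness and the effective domain of the dual objective *)

Let K_complementary z x : K z `^ (1 - q) * pw q (- (K z * dpw p x)) = K z * pw p x.
Proof.
rewrite pwN pwM (_ : pw q (dpw p x) = pw p x); last exact: dpw_conjugate.
rewrite mulrA; congr (_ * _); rewrite /pw (ger0_norm (ltW (K0 z))) -powRD.
  by rewrite subrK powRr1// ltW.
by rewrite (gt_eqF (K0 z)) implybT.
Qed.

(** The equality case of Young's inequality: K^(1-q) (K |x|^(p-1))^q = K |x|^p. *)
Lemma complementary_dpw u :
  complementary (fun z => - (K z * dpw p (G u z))) = q^-1 * energy u.
Proof.
rewrite /complementary; under eq_Rintegral do rewrite K_complementary.
by [].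
Qed.

Lemma pairing_dpw u : admissible u ->
  \int[nu]_z (- (K z * dpw p (G u z)) * G u z) = - energy u.
Proof.
move=> [_ _ Gup]; rewrite /energy -mulN1r -RintZ; last exact: K_pw_rint.
by apply: eq_Rint => z; rewrite mulNr -mulrA dpwE// mulN1r.
Qed.

Lemma primal_dual_pair f : f \in Lfun mu q%:E ->
  exists u s, [/\ admissible u, is_div s f, complementary s = - primal f u &
    forall v, admissible v -> primal f u <= primal f v].
Proof.
move=> fq; have zp : (fun=> 0) \in Lfun mu p%:E by have [] := admissible0.
have [u Uu [su umin]] := proximal_solution (lexx 0) zp fq.
have fE : (fun x => f x - 0 * dpw p (u x - 0)) = f.
  by apply/funext => x; rewrite mul0r subr0.
rewrite fE in su.
have phiE v : functional 0 (fun=> 0) f v = primal f v.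
  by rewrite /functional !mul0r addr0.
exists u, (fun z => - (K z * dpw p (G u z))); split => //.
  (* Testing the divergence with u itself gives \int f u = energy u, and 1 / q = 1 - 1 / p. *)
  rewrite complementary_dpw /primal; have [_ _ /(_ _ Uu)->] := su.
  rewrite pairing_dpw// opprK (_ : q^-1 = 1 - p^-1); first by ring.
  by rewrite -pq addrC addKr.
by move=> v Uv; rewrite -!phiE; exact: umin.
Qed.

(** Two minimisers satisfy the estimate of [minimizing_cauchy] for every r > 0, so their L^p
    distance vanishes. *)
Lemma primal_minimizer_unique f u v : f \in Lfun mu q%:E ->
  admissible u -> admissible v ->
  (forall w, admissible w -> primal f u <= primal f w) ->
  primal f v = primal f u -> {ae mu, forall x, v x = u x}.
Proof.
move=> fq Uu Uv umin uv.
have zp : (fun=> 0) \in Lfun mu p%:E by have [] := admissible0.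
have phiE w : functional 0 (fun=> 0) f w = primal f w.
  by rewrite /functional !mul0r addr0.
have [_ up _] := Uu; have [_ vp _] := Uv.
have dp : (fun x => v x - u x) \in Lfun mu p%:E by exact: LfunB.
have d0 : \int[mu]_x pw p (v x - u x) <= 0.
  apply/ler_addgt0Pr => r r0; rewrite add0r.
  have hm w : admissible w -> primal f u <= functional 0 (fun=> 0) f w.
    by rewrite phiE; exact: umin.
  have [e e0 he] := minimizing_cauchy (lexx 0) zp fq r0 hm.
  by apply: he => //; rewrite phiE ?uv ltrDl.
have rd : rint mu (fun x => pw p (v x - u x)) by exact: Lfun_pw.
have : (\int[mu]_x `|(pw p (v x - u x))%:E| = 0)%E.
  under eq_integral do rewrite gee0_abs ?lee_fin ?pw_ge0//.
  rewrite EFin_rint//; congr EFin; apply/eqP; rewrite eq_le d0/=.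
  by apply: Rintegral_ge0 => x _; exact: pw_ge0.
have mrd : measurable_fun [set: X] (fun x => (pw p (v x - u x))%:E).
  by case/integrableP : rd.
move=> /(ae_eq_integral_abs mu measurableT mrd).
apply: filterS => x /(_ I) [] /pw_eq0 /eqP.
by rewrite subr_eq0 => /eqP.
Qed.

(* Test with the proximal fields for f = 0 and h = u: their parameter t tends to
   infinity, which forces the minimisers to converge to u with bounded energy. *)
Lemma dual_bound f u M : f \in Lfun mu q%:E -> u \in Lfun mu p%:E ->
  (forall x, ~ Om x -> u x = 0) ->
  (forall s g, is_div s g ->
    - M <= complementary s + \int[mu]_x ((f x - g x) * u x)) ->
  admissible u /\ primal f u <= M.
Proof.
move=> fq up uOm uM.
have zq : (fun=> 0) \in Lfun mu q%:E.
  by apply: pw_Lfun => //; rewrite pw0// integral0 ltry.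
pose M' := M + \int[mu]_x (f x * u x).
have key t : 0 <= t -> exists v, [/\ admissible v, energy v <= p * M' &
    t * \int[mu]_x pw p (v x - u x) <= M'].
  move=> t0; have [v Uv [sv _]] := proximal_solution t0 up zq; exists v.
  have [_ vp Gvp] := Uv.
  have rf : rint mu (fun x => f x * u x) by exact: (Lfun_mulr p1 pq).
  have dp : (fun x => v x - u x) \in Lfun mu p%:E by exact: LfunB.
  have := uM _ _ sv; rewrite complementary_dpw.
  have [_ gq /(_ _ Uv)] := sv; rewrite pairing_dpw// opprK.
  set g := (fun x => 0 - _) in gq *.
  have rgv : rint mu (fun x => g x * v x) by exact: (Lfun_mulr p1 pq).
  (* Write g u = g v - g (v - u), where \int g v = energy v and - g (v - u) = t |v - u|^p. The
     assumed lower bound then reads energy v / p + t \int |v - u|^p <= M'. *)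
  have -> : \int[mu]_x ((f x - g x) * u x) = \int[mu]_x (f x * u x)
      - (\int[mu]_x (g x * v x) + t * \int[mu]_x pw p (v x - u x)).
    have rp : rint mu (fun x => t * pw p (v x - u x)).
      by apply: rintZ; exact: Lfun_pw.
    rewrite -RintZ; last exact: Lfun_pw.
    rewrite -RintD// -RintB//; last exact: rintD.
    apply: eq_Rint => x; rewrite -dpwE//; rewrite /g; ring.
  move=> ->; set E := energy v; set D := \int[mu]_x pw p (v x - u x) => h.
  have E0 : 0 <= E by exact: energy_ge0.
  have D0 : 0 <= t * D.
    by rewrite mulr_ge0//; apply: Rintegral_ge0 => x _; exact: pw_ge0.
  have iq : q^-1 * E = E - p^-1 * E.
    by rewrite (_ : q^-1 = 1 - p^-1) ?mulrBl ?mul1r// -pq addrC addKr.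
  have pE0 : 0 <= p^-1 * E by rewrite mulr_ge0 ?invr_ge0// ltW.
  have h' : p^-1 * E + t * D <= M'.
    rewrite iq in h; rewrite /M'; move: h.
    by move: (\int[mu]_x (f x * u x)) => L h; lra.
  split => //; last by apply: le_trans h'; rewrite lerDr.
  by rewrite -ler_pdivrMl// (le_trans _ h')// lerDl.
have M'0 : 0 <= M' by have [v []] := key 0 (lexx _); rewrite mul0r.
(* This yields \int |v_ k - u|^p <= M' / t_ k <= 2^-(k+1), as [ae_cvg0] requires; the + 1 keeps
   [t_ k] positive when M' = 0. *)
pose t_ k : R := (M' + 1) * (2 ^ (k + 1))%:R.
have t0 k : 0 < t_ k by rewrite mulr_gt0 ?ltr_wpDl// ltr0n expn_gt0.
have [v_ hv_] : {v_ : nat -> X -> R & forall k, [/\ admissible (v_ k),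
    energy (v_ k) <= p * M' & t_ k * \int[mu]_x pw p (v_ k x - u x) <= M']}.
  by apply: (@choice _ _ (fun k v => [/\ admissible v, energy v <= p * M' &
    t_ k * \int[mu]_x pw p (v x - u x) <= M'])) => k; exact: key (ltW (t0 k)).
have Uv_ k : admissible (v_ k) by have [] := hv_ k.
have vp_ k : v_ k \in Lfun mu p%:E by have [] := Uv_ k.
have mu_u := Lfun_measurable up.
have v_u : {ae mu, forall x, v_ ^~ x @ \oo --> u x}.
  have : {ae mu, forall x, (fun k => pw p (v_ k x - u x)) @ \oo --> (0 : R)}.
    apply: ae_cvg0; last 2 first.
    - by move=> k x; exact: pw_ge0.
    - move=> k; rewrite EFin_rint ?lee_fin; last first.
        by apply: Lfun_pw => //; exact: LfunB.
      have [_ _] := hv_ k; rewrite -ler_pdivlMl// => /le_trans; apply.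
      rewrite /t_ invfM mul1r mulrAC -[leRHS]mul1r.
      rewrite ler_pM2r ?invr_gt0 ?ltr0n ?expn_gt0//.
      by rewrite ler_pdivrMl ?mulr1 ?ltr_wpDl// lerDl.
    - move=> k; apply: measurable_pw; apply: measurable_funB => //.
      exact: Lfun_measurable (vp_ k).
  apply: filterS => x hx; apply/cvgrPdist_lt => e e0.
  have ep : 0 < e `^ p by exact: powR_gt0.
  move/cvgrPdist_lt : hx => /(_ _ ep); apply: filterS => k.
  rewrite sub0r normrN (ger0_norm (pw_ge0 _ _)) distrC => hk.
  rewrite ltNge; apply/negP => h; move: hk; rewrite ltNge => /negP; apply.
  by apply: ge0_ler_powR; rewrite ?nnegrE// ltW.
have vM k : energy (v_ k) <= p * M' by have [] := hv_ k.
have [Uu uE] := admissible_limit Uv_ vM mu_u up uOm v_u.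
split => //; rewrite /primal lerBlDr -/M'.
by rewrite ler_pdivrMl.
Qed.

End abstract_problem.

(** * The nonlocal problem *)

Section rV_measurability.
Context {R : realType} {n : nat}.
Local Notation E := 'rV[R]_n.

(** The sigma-algebra is generated by the coordinates, so an open set has to be exhibited as a
    countable union of boxes with rational data. *)
Lemma open_measurable_rV (U : set E) : open U -> measurable U.
Proof.
move=> oU.
pose box (c : 'rV[rat]_n * rat) : set E :=
  \bigcap_(i in [set: 'I_n]) [set x : E | `|x ord0 i - ratr (c.1 ord0 i)| < ratr c.2].
have mbox c : measurable (box c).
  apply: fin_bigcap_measurable => // i _.
  have mf : measurable_fun [set: E] (fun x : E => `|x ord0 i - ratr (c.1 ord0 i)|).
    apply: measurableT_comp => //; apply: measurable_funB => //.
    exact: measurable_rV_coord.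
  have -> : [set x : E | `|x ord0 i - ratr (c.1 ord0 i)| < ratr c.2] =
      [set: E] `&` (fun x : E => `|x ord0 i - ratr (c.1 ord0 i)|) @^-1` `]-oo, ratr c.2[.
    by rewrite setTI; apply/predeqP => x /=; rewrite in_itv.
  by apply: mf => //; exact: measurable_itv.
pose S := [set c : 'rV[rat]_n * rat | box c `<=` U].
have UE : U = \bigcup_(c in S) box c.
  apply/predeqP => x; split=> [Ux|[c cU]]; last exact: cU.
  have /nbhs_ballP[e /= e0 eU] : nbhs x U by apply: open_nbhs_nbhs.
  have e40 : 0 < e / 4 by rewrite divr_gt0.
  (* A box of half-width r between e / 4 and e / 2, centred within e / 4 of x in each coordinate,
     contains x and lies in the ball of radius e. *)
  have [r] : exists r : rat, ratr r \in `]e / 4, e / 2[.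
    apply: rat_in_itvoo; lra.
  rewrite in_itv/= => /andP[r1 r2].
  have [c hc] : {c : 'I_n -> rat & forall i, `|x ord0 i - ratr (c i)| < e / 4}.
    apply: (@choice _ _ (fun i c => `|x ord0 i - ratr c| < e / 4)) => i.
    have hx : x ord0 i - e / 4 < x ord0 i + e / 4 by lra.
    have [s] := rat_in_itvoo hx.
    rewrite in_itv/= => hs; exists s; rewrite ltr_norml; lra.
  exists (\row_i c i, r); last first.
    by move=> i _ /=; rewrite mxE (lt_trans (hc i)).
  move=> y hy; apply: eU; split => // i j; rewrite ord1 /ball/=.
  have := hy j I; rewrite /= mxE => hyj; have := hc j.
  rewrite !ltr_norml in hyj * => hcj; lra.
rewrite UE bigcup_mkcond; apply: countable_bigcupT_measurable.
  exact: countableP.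
by move=> c; case: ifP.
Qed.

Lemma continuous_enormB (x : E) : continuous (fun y : E => enorm (y - x)).
Proof.
move=> y.
have hc i : (z - x) ord0 i @[z --> y] --> (y - x) ord0 i.
  have hz : z ord0 i @[z --> y] --> y ord0 i by exact: coord_continuous.
  rewrite (_ : (fun z : E => _) = fun z : E => z ord0 i - x ord0 i).
    rewrite !mxE; apply: cvgB; [exact: (@nbhs_filter E y)|exact: hz|].
    by apply: cvg_cst; exact: (@nbhs_filter E y).
  by apply/funext => z; rewrite !mxE.
have hs : edot (z - x) (z - x) @[z --> y] --> edot (y - x) (y - x).
  have Fy : Filter (nbhs y) by exact: (@nbhs_filter E y).
  apply: cvg_big => [|i _]; first exact: add_continuous.
  by apply: cvgM; exact: hc.
exact: (cvg_comp _ _ hs (@sqrt_continuous _ _)).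
Qed.

Lemma measurable_enlarge (Omega : set E) delta : measurable (enlarge Omega delta).
Proof.
apply: open_measurable_rV; apply: bigcup_open => x _.
rewrite (_ : eball x delta = (fun y : E => enorm (y - x)) @^-1` [set r | r < delta]); last by [].
apply: open_comp; last exact: open_lt.
by move=> y _; exact: continuous_enormB.
Qed.

End rV_measurability.

(** * Extension by zero *)

Section restriction.
Context {R : realType}.

Lemma patchK T (A : set T) (f : T -> R) : (f \_ A) \_ A = f \_ A.
Proof.
apply/funext => x; rewrite [LHS]patchE; case: ifPn => // Ax.
by rewrite patchE (negbTE Ax).
Qed.

Lemma patch_supported T (A : set T) (f : T -> R) :
  (forall x, ~ A x -> f x = 0) -> f \_ A = f.
Proof.
move=> f0; apply/funext => x; rewrite patchE; case: ifPn => // /negP Ax.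
by rewrite f0// => ?; apply: Ax; rewrite inE.
Qed.

Lemma patch_out T (A : set T) (f : T -> R) x : ~ A x -> (f \_ A) x = 0.
Proof. by move=> Ax; rewrite patchE memNset. Qed.

Lemma Lfun_restrict d (T : measurableType d) (mu : {measure set T -> \bar R})
    (r : R) (A : set T) (f : T -> R) : 1 < r -> measurable A ->
  f \in Lfun mu r%:E -> f \_ A \in Lfun mu r%:E.
Proof.
move=> r1 mA fr; have mf := Lfun_measurable fr.
have mfA : measurable_fun [set: T] (f \_ A).
  by apply/(measurable_restrictT _ mA); exact: measurable_funTS.
apply: pw_Lfun => //.
rewrite EFin_rint ?ltry//; apply: (rint_le _ (Lfun_pw r1 fr)).
  exact: measurable_pw.
move=> x; rewrite ger0_norm ?pw_ge0// patchE; case: ifP => // _.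
by rewrite (pw0 r1) pw_ge0.
Qed.

Lemma integral_patch d (T : measurableType d) (mu : {measure set T -> \bar R})
    (A : set T) (f : T -> R) :
  (\int[mu]_(x in A) (f x)%:E = \int[mu]_x ((f \_ A) x)%:E)%E.
Proof.
by rewrite integral_mkcond; under eq_integral do rewrite restrict_EFin.
Qed.

Lemma integral_mul_patch d (T : measurableType d) (mu : {measure set T -> \bar R})
    (A : set T) (f g : T -> R) : rint mu (fun x => (f \_ A) x * (g \_ A) x) ->
  (\int[mu]_(x in A) (f x * g x)%:E)%E =
  (\int[mu]_x ((f \_ A) x * (g \_ A) x))%:E.
Proof.
move=> rfg; rewrite -EFin_rint// [LHS]integral_patch; apply: eq_integral => x _.
by rewrite !patchE; case: ifP => // _; rewrite mulr0.
Qed.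

End restriction.

(** * The nonlocal gradient as an instance of the abstract operator *)

Section transfer.
Context {R : realType} {n : nat}.
Local Notation E := 'rV[R]_n.
Local Notation leb := (lebesgue_rV n).
Local Notation leb2 := (leb \x leb)%E.
Variables (p q : R) (Omega : set E) (delta : R) (w : E -> R).
Hypotheses (p1 : 1 < p) (pq : p^-1 + q^-1 = 1).
Hypotheses (oOmega : open Omega) (mw : measurable_fun [set: E] w).
Local Notation D := (nl_dom Omega delta).

Let p0 : 0 < p. Proof. exact: lt_trans p1. Qed.
Let q1 : 1 < q. Proof. exact: conjugate_gt1 p1 pq. Qed.

Let mOmega : measurable Omega. Proof. exact: open_measurable_rV. Qed.

Let mD : measurable D.
Proof. by apply: measurableX; exact: measurable_enlarge. Qed.

Definition nlG (u : E -> R) : E * E -> R := nl_grad Omega w u \_ D.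

Lemma nlG_linear u v c z :
  nlG (fun x => u x + c * v x) z = nlG u z + c * nlG v z.
Proof.
rewrite /nlG !patchE; case: ifP => _; last by rewrite mulr0 addr0.
have h x : ((fun x => u x + c * v x) \_ Omega) x =
    (u \_ Omega) x + c * (v \_ Omega) x.
  by rewrite !patchE; case: ifP => _; rewrite ?mulr0 ?addr0.
by rewrite /nl_grad !h; ring.
Qed.

Lemma measurable_nlG u :
  measurable_fun [set: E] u -> measurable_fun [set: E * E] (nlG u).
Proof.
move=> mu; apply/(measurable_restrictT _ mD).
have mu' : measurable_fun [set: E] (u \_ Omega).
  by apply/(measurable_restrictT _ mOmega); exact: measurable_funTS.
apply: measurable_funTS; apply: measurable_funM.
  apply: measurable_funB.
    exact: (measurableT_comp mu' measurable_fst).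
  exact: (measurableT_comp mu' measurable_snd).
apply: (measurableT_comp mw); apply: measurable_fun_rVP => i.
rewrite (_ : (fun _ => _) = fun z : E * E => z.1 ord0 i - z.2 ord0 i).
  apply: measurable_funB.
    exact: (measurableT_comp (measurable_rV_coord i) measurable_fst).
  exact: (measurableT_comp (measurable_rV_coord i) measurable_snd).
by apply/funext => z; rewrite !mxE.
Qed.

(** The gradient at a pair of points sees u only at these two points, so convergence can fail only
    on N x E or E x N, both null for the product measure. *)
Lemma nlG_closed (u_ : nat -> E -> R) u :
  {ae leb, forall x, u_ ^~ x @ \oo --> u x} ->
  {ae leb2, forall z, nlG (u_ k) z @[k --> \oo] --> nlG u z}.
Proof.
move=> [N [mN N0 sN]].
exists (N `*` setT `|` setT `*` N); split.
- by apply: measurableU; apply: measurableX.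
- have m1 : measurable (N `*` [set: E]) by exact: measurableX.
  have m2 : measurable ([set: E] `*` N) by exact: measurableX.
  have e1 : leb2 (N `*` [set: E]) = 0%E.
    by rewrite product_measure1E// [X in (X * _)%E](_ : _ = 0%E) ?mul0e//; exact: N0.
  have e2 : leb2 ([set: E] `*` N) = 0%E.
    by rewrite product_measure1E// [X in (_ * X)%E](_ : _ = 0%E) ?mule0//; exact: N0.
  apply/eqP; rewrite -measure_le0 (le_trans (measureU2 _ _ _))//.
  by rewrite [X in (X + _)%E]e1 [X in (_ + X)%E]e2 adde0.
move=> z /= hz; apply: contrapT => hN; apply: hz.
have hx x : ~ N x -> u_ k x @[k --> \oo] --> u x.
  by move=> Nx; apply: contrapT => hx; apply: Nx; exact: sN.
have h1 : u_ k z.1 @[k --> \oo] --> u z.1.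
  by apply: hx => Nz; apply: hN; left.
have h2 : u_ k z.2 @[k --> \oo] --> u z.2.
  by apply: hx => Nz; apply: hN; right.
have hr x : u_ k x @[k --> \oo] --> u x ->
    (u_ k \_ Omega) x @[k --> \oo] --> (u \_ Omega) x.
  move=> ux; rewrite patchE; under eq_cvg do rewrite patchE.
  by case: ifP => _ //; exact: cvg_cst.
rewrite /nlG patchE; under eq_cvg do rewrite patchE.
case: ifP => _; last exact: cvg_cst.
apply: cvgM; last exact: cvg_cst.
by apply: cvgB; exact: hr.
Qed.

Lemma nlG_patch u : nlG (u \_ Omega) = nlG u.
Proof. by rewrite /nlG /nl_grad patchK. Qed.

Local Notation admissible := (admissible leb leb2 p Omega nlG).

Lemma U0_admissible u : U0 p Omega delta w u <-> admissible (u \_ Omega).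
Proof.
split=> [[up Gup]|[_ up Gup]]; last first.
  by split => //; rewrite nlG_patch in Gup.
by split => //; [move=> x; exact: patch_out|rewrite nlG_patch].
Qed.

Lemma poincare_nlG (C : R) : 0 < C ->
  (forall u, U0 p Omega delta w u ->
    ('N[leb]_(p%:E)[EFin \o (u \_ Omega)] <= C%:E * 'N[leb2]_(p%:E)[
       EFin \o (nl_grad Omega w u \_ D)])%E) ->
  forall u, admissible u ->
    \int[leb]_x pw p (u x) <= C `^ p * \int[leb2]_z pw p (nlG u z).
Proof.
move=> C0 hC u [uO up Gup].
have uE := patch_supported uO.
have Uu : U0 p Omega delta w u by apply/U0_admissible; rewrite uE.
have pe : p != 0 by rewrite gt_eqF.
have LE d (T : measurableType d) (mu : {measure set T -> \bar R}) f :
    f \in Lfun mu p%:E ->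
    ('N[mu]_(p%:E)[EFin \o f] `^ p = (\int[mu]_x pw p (f x))%:E)%E.
  by move=> fp; rewrite powR_Lnorm// -EFin_rint//; exact: Lfun_pw.
have := hC _ Uu; rewrite uE => h.
have : ('N[leb]_(p%:E)[EFin \o u] `^ p <=
    (C%:E * 'N[leb2]_(p%:E)[EFin \o nlG u]) `^ p)%E.
  have CN : (0 <= C%:E * 'N[leb2]_(p%:E)[EFin \o nlG u])%E.
    by rewrite mule_ge0 ?Lnorm_ge0// lee_fin ltW.
  apply: gt0_ler_poweR => //; first exact: ltW.
    by rewrite in_itv/= Lnorm_ge0 leey.
  by rewrite in_itv/= CN leey.
rewrite poweRM ?Lnorm_ge0 ?lee_fin ?(ltW C0)// !LE//.
Qed.

(** * Energies, divergences and Lagrangians in abstract form *)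

Section conductivity.
Variables (kappa : E * E -> R) (klo khi : R).
Hypotheses (klo0 : 0 < klo) (klohi : klo <= khi).
Hypothesis mkappa : measurable_fun [set: E * E] (kappa \_ D).
Hypothesis kappa_bounds : {ae leb2, forall z, D z -> klo <= kappa z <= khi}.

(* [kappa] obeys its bounds only a.e. on [D]; [clamp] obeys them everywhere. *)
Definition clamp z := Num.max klo (Num.min khi ((kappa \_ D) z)).

Lemma measurable_clamp : measurable_fun [set: E * E] clamp.
Proof.
apply: measurable_maxr; first exact: measurable_cst.
by apply: measurable_minr => //; exact: measurable_cst.
Qed.

Lemma clamp_bounds z : klo <= clamp z <= khi.
Proof. by rewrite le_max lexx ge_max klohi ge_min lexx. Qed.

Lemma clamp_ae : {ae leb2, forall z, D z -> kappa z = clamp z}.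
Proof.
apply: filterS kappa_bounds => z kz Dz; have /andP[k1 k2] := kz Dz.
by rewrite /clamp patchE mem_set// (min_idPr k2) (max_idPr k1).
Qed.

Local Notation energy := (energy leb2 p nlG clamp).
Local Notation primal := (primal leb leb2 p nlG clamp).
Local Notation complementary := (complementary leb2 q clamp).
Local Notation is_div := (is_div leb leb2 p q Omega nlG).

Lemma energyE u : admissible u ->
  (\int[leb2]_(z in D) (kappa z * `|nl_grad Omega w u z| `^ p)%:E)%E = (energy u)%:E.
Proof.
move=> Uu; have [_ _ Gup] := Uu.
rewrite -EFin_rint; last exact: (K_pw_rint p1 klo0 measurable_clamp clamp_bounds).
rewrite [LHS]integral_patch (_ : _ \_ D = fun z => (kappa \_ D) z * pw p (nlG u z)); last first.
  by apply/funext => z; rewrite /nlG !patchE; case: ifP => // _; rewrite mul0r.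
have mG : measurable_fun [set: E * E] (fun z => pw p (nlG u z)).
  by apply: measurable_pw; exact: Lfun_measurable Gup.
apply: ae_eq_integral => //.
- by apply/measurable_EFinP; exact: measurable_funM.
- by apply/measurable_EFinP; apply: measurable_funM => //; exact: measurable_clamp.
apply: filterS clamp_ae => z hz _; congr EFin.
have [Dz|Dz] := pselect (D z); first by rewrite patchE mem_set// hz.
by rewrite /nlG !patch_out// pw0// !mulr0.
Qed.

Let nl_gradE u : nl_grad Omega w (u \_ Omega) = nl_grad Omega w u.
Proof. by rewrite /nl_grad patchK. Qed.

Lemma Icheck_primal f u : f \_ Omega \in Lfun leb q%:E -> U0 p Omega delta w u ->
  Icheck p Omega delta w kappa f u = (primal (f \_ Omega) (u \_ Omega))%:E.
Proof.
move=> fq /U0_admissible Uu; have [_ up _] := Uu.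
rewrite /Icheck /primal EFinB EFinM -energyE//.
by rewrite nl_gradE (@integral_mul_patch R _ _ leb Omega f u)//; exact: (Lfun_mulr p1 pq).
Qed.

Lemma Ihat_complementary s : s \_ D \in Lfun leb2 q%:E ->
  Ihat q Omega delta kappa s = (complementary (s \_ D))%:E.
Proof.
move=> sq; rewrite /Ihat /complementary EFinM; congr (_ * _)%E.
rewrite -EFin_rint; last exact: (complementary_rint p1 pq klo0 measurable_clamp clamp_bounds).
rewrite [LHS]integral_patch (_ : _ \_ D =
    fun z => (kappa \_ D) z `^ (1 - q) * pw q ((s \_ D) z)); last first.
  apply/funext => z; rewrite !patchE; case: ifP => // _.
  by rewrite pw0// mulr0.
have mG : measurable_fun [set: E * E] (fun z => pw q ((s \_ D) z)).
  by apply: measurable_pw; exact: Lfun_measurable sq.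
apply: ae_eq_integral => //.
- apply/measurable_EFinP; apply: measurable_funM => //.
  exact: (measurableT_comp (measurable_powR _)).
- apply/measurable_EFinP; apply: measurable_funM => //.
  exact: (measurableT_comp (measurable_powR _) measurable_clamp).
apply: filterS clamp_ae => z hz _; congr EFin.
have [Dz|Dz] := pselect (D z); first by rewrite patchE mem_set// hz.
by rewrite !patch_out// pw0// !mulr0.
Qed.

(** The two notions test with different representatives, arbitrary ones on the left and zero
    extensions on the right; [nlG_patch] identifies their gradients. *)
Lemma is_nl_divP s g : is_nl_div p q Omega delta w s g <->
  is_div (s \_ D) (g \_ Omega).
Proof.
have pairing u : s \_ D \in Lfun leb2 q%:E -> g \_ Omega \in Lfun leb q%:E ->
    U0 p Omega delta w u ->
    ((\int[leb]_(x in Omega) (g x * u x)%:E =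
      - \int[leb2]_(z in D) (s z * nl_grad Omega w u z)%:E)%E <->
     \int[leb]_x ((g \_ Omega) x * (u \_ Omega) x) =
     - \int[leb2]_z ((s \_ D) z * nlG (u \_ Omega) z)).
  move=> sq gq /U0_admissible[_ up Gup].
  rewrite integral_mul_patch; last exact: (Lfun_mulr p1 pq).
  rewrite nlG_patch in Gup *.
  rewrite integral_mul_patch; last exact: (Lfun_mulr p1 pq).
  by split=> [[]|->].
split=> [[sq gq h]|[sq gq h]]; split => // u Uu.
  have uE : u \_ Omega = u by apply: patch_supported; case: Uu.
  have Uu' : U0 p Omega delta w u by apply/U0_admissible; rewrite uE.
  by have /(pairing _ sq gq Uu') := h _ Uu'; rewrite uE.
by apply/pairing => //; apply: h; exact/U0_admissible.
Qed.

(** Abstract fields live on the whole product space. Cutting them off outside D leaves their pairing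
    with gradients unchanged and can only lower their energy, so bounds valid for nonlocal fields
    extend to abstract ones. *)
Lemma complementary_patch s : s \in Lfun leb2 q%:E ->
  complementary (s \_ D) <= complementary s.
Proof.
move=> sq; have sDq := Lfun_restrict q1 mD sq.
rewrite /complementary ler_pM2l ?invr_gt0 ?(lt_trans _ q1)//.
apply: le_Rint.
- exact: (complementary_rint p1 pq klo0 measurable_clamp clamp_bounds).
- exact: (complementary_rint p1 pq klo0 measurable_clamp clamp_bounds).
move=> z; rewrite ler_wpM2l ?powR_ge0// patchE; case: ifP => // _.
by rewrite pw0// pw_ge0.
Qed.

Lemma is_div_is_nl_div s g : is_div s g -> is_nl_div p q Omega delta w s g.
Proof.
move=> [sq gq h]; apply/is_nl_divP; split; [exact: Lfun_restrict..|].
move=> u Uu; have [uO up Gup] := Uu.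
transitivity (\int[leb]_x (g x * u x)).
  apply: eq_Rint => x; have [Ox|Ox] := pselect (Omega x).
    by rewrite patchE mem_set.
  by rewrite uO// !mulr0.
rewrite h//; congr (- _); apply: eq_Rint => z.
rewrite /nlG !patchE; case: ifP => // _; by rewrite !mulr0.
Qed.

Lemma lagrangianE f s g u : f \_ Omega \in Lfun leb q%:E ->
  u \_ Omega \in Lfun leb p%:E -> is_nl_div p q Omega delta w s g ->
  lagrangian q Omega delta kappa f s g u = (complementary (s \_ D) +
    \int[leb]_x (((f \_ Omega) x - (g \_ Omega) x) * (u \_ Omega) x))%:E.
Proof.
move=> fq up [sq gq _]; rewrite /lagrangian Ihat_complementary// EFinD; congr (_ + _)%E.
have -> : (fun x => ((f \_ Omega) x - (g \_ Omega) x) * (u \_ Omega) x) =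
    (fun x => ((fun x => f x - g x) \_ Omega) x * (u \_ Omega) x).
  by apply/funext => x; rewrite !patchE; case: ifP => // _; rewrite subr0.
apply: integral_mul_patch; apply: (Lfun_mulr p1 pq) => //.
rewrite (_ : _ \_ Omega = fun x => (f \_ Omega) x - (g \_ Omega) x).
  exact: LfunB.
by apply/funext => x; rewrite !patchE; case: ifP => // _; rewrite subr0.
Qed.

(** * The dual objective and strong duality in extended reals *)

Section duality.
Variables (Cp : R) (f : E -> R).
Hypothesis Cp0 : 0 < Cp.
Hypothesis poincare : forall u, admissible u ->
  \int[leb]_x pw p (u x) <= Cp * \int[leb2]_z pw p (nlG u z).
Hypothesis fq : f \_ Omega \in Lfun leb q%:E.

Local Notation U0 := (U0 p Omega delta w).
Local Notation Icheck := (Icheck p Omega delta w kappa f).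
Local Notation dual_obj := (dual_obj p q Omega delta w kappa f).
Local Notation dual_val := (dual_val p q Omega delta w kappa f).
Local Notation icheck := (icheck p Omega delta w kappa f).

Lemma dual_obj_ge u : U0 u -> (- Icheck u <= dual_obj u)%E.
Proof.
move=> Uu; have Au := (U0_admissible u).1 Uu; have [_ up _] := Au.
apply: le_ereal_inf_tmp => _ [[s g] /= sg <-].
rewrite lagrangianE// Icheck_primal// -EFinN lee_fin.
apply: (weak_duality p1 pq klo0 measurable_clamp clamp_bounds fq Au).
exact/is_nl_divP.
Qed.

Lemma dual_obj_bound u M : Lr leb Omega p%:E u -> ((- M)%:E <= dual_obj u)%E ->
  U0 u /\ (Icheck u <= M%:E)%E.
Proof.
move=> up Mu.
have [Au uM] : admissible (u \_ Omega) /\ primal (f \_ Omega) (u \_ Omega) <= M.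
  apply: (dual_bound p1 pq nlG_linear measurable_nlG nlG_closed klo0
    measurable_clamp clamp_bounds Cp0 poincare fq up) => [x|s g sg].
    exact: patch_out.
  have nsg := is_div_is_nl_div sg.
  have [sq gq _] := sg.
  have : (dual_obj u <= lagrangian q Omega delta kappa f s g u)%E.
    by apply: ereal_inf_lbound; exists (s, g).
  move=> /(le_trans Mu).
  rewrite lagrangianE// lee_fin => /le_trans; apply.
  apply: lerD; first exact: complementary_patch.
  apply: eq_ler; apply: eq_Rint => x.
  rewrite [(g \_ _) x]patchE; case: ifPn => // Ox.
  by rewrite [(u \_ _) x]patchE (negbTE Ox) !mulr0.
have Uu := (U0_admissible u).2 Au.
by split => //; rewrite Icheck_primal// lee_fin.
Qed.

Lemma dual_obj_U0 u : U0 u -> dual_obj u = (- Icheck u)%E.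
Proof.
move=> Uu; have [up _] := Uu; apply/eqP; rewrite eq_le dual_obj_ge// andbT.
rewrite Icheck_primal// -EFinN.
apply/lee_addgt0Pr => e e0; rewrite leNgt; apply/negP => h.
(* With P the primal value, a dual objective above - P + e would give P <= P - e by [dual_obj_bound]
   with M = P - e. *)
have {}h : ((- (primal (f \_ Omega) (u \_ Omega) - e))%:E <= dual_obj u)%E.
  by rewrite opprB addrC EFinD ltW.
have [_] := dual_obj_bound up h.
by rewrite Icheck_primal// lee_fin; move: (primal _ _) => P; lra.
Qed.

(** Any real lower bound on the dual objective would make u admissible by [dual_obj_bound]. *)
Lemma dual_obj_notU0 u : Lr leb Omega p%:E u -> ~ U0 u -> dual_obj u = -oo%E.
Proof.
move=> up Uu; apply: eq_ninfty => M; rewrite leNgt; apply/negP => h.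
have {}h : ((- - M)%:E <= dual_obj u)%E by rewrite opprK ltW.
by apply: Uu; have [] := dual_obj_bound up h.
Qed.

Lemma dual_valE : dual_val = ereal_sup [set (- Icheck u)%E | u in U0].
Proof.
apply/eqP; rewrite eq_le; apply/andP; split.
  apply: ge_ereal_sup => _ [u up <-].
  have [Uu|Uu] := pselect (U0 u).
    by rewrite dual_obj_U0//; apply: ereal_sup_ubound; exists u.
  by rewrite dual_obj_notU0// leNye.
apply: ge_ereal_sup => _ [u Uu <-]; apply: ereal_sup_ubound.
by exists u; [case: Uu|rewrite dual_obj_U0].
Qed.

Lemma duality : exists u, [/\ U0 u, Icheck u \is a fin_num, icheck = Icheck u,
  (ihat p q Omega delta w kappa f = - Icheck u)%E &
  forall v, U0 v -> Icheck v = Icheck u ->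
    {ae leb, forall x, Omega x -> v x = u x}].
Proof.
have [u [s [Au sf su umin]]] := primal_dual_pair p1 pq nlG_linear
  measurable_nlG nlG_closed klo0 measurable_clamp clamp_bounds Cp0 poincare fq.
have [uO up Gup] := Au.
have uE := patch_supported uO.
have Uu : U0 u by apply/U0_admissible; rewrite uE.
(* The abstract pair has divergence f extended by zero, which is the same element of L^q(Omega) as
   f. *)
have nsf : is_nl_div p q Omega delta w s f.
  by have /is_nl_divP := is_div_is_nl_div sf; rewrite patchK => /is_nl_divP.
have sq : s \in Lfun leb2 q%:E by case: sf.
have IuE : Icheck u = (primal (f \_ Omega) u)%:E by rewrite Icheck_primal// uE.
exists u; split => //.
- by rewrite IuE.
- apply/eqP; rewrite eq_le; apply/andP; split.
    by apply: ereal_inf_lbound; exists u.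
  apply: le_ereal_inf_tmp => _ [v Uv <-].
  by rewrite IuE Icheck_primal// lee_fin; apply: umin; exact/U0_admissible.
- apply/eqP; rewrite eq_le; apply/andP; split.
    apply: (@le_trans _ _ (Ihat q Omega delta kappa s)).
      by apply: ereal_inf_lbound; exists s.
    rewrite Ihat_complementary; last by case: nsf.
    by rewrite IuE -EFinN lee_fin -su complementary_patch.
  apply: le_ereal_inf_tmp => _ [r rf <-].
  have rq : r \_ D \in Lfun leb2 q%:E by case: rf.
  rewrite Ihat_complementary// IuE -EFinN lee_fin.
  have /is_nl_divP rf' := rf.
  have := weak_duality p1 pq klo0 measurable_clamp clamp_bounds fq Au rf'.
  (* The divergence of [r] is [f], so the linear term of the Lagrangian vanishes. *)
  rewrite [X in _ + X](_ : _ = 0) ?addr0//.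
  rewrite (_ : (fun _ => _) = fun=> 0); last first.
    by apply/funext => x; rewrite subrr mul0r.
  by rewrite /Rintegral integral0.
- move=> v Uv; rewrite IuE Icheck_primal// => -[uv].
  have := primal_minimizer_unique p1 pq nlG_linear klo0
    measurable_clamp clamp_bounds Cp0 poincare fq Au ((U0_admissible v).1 Uv) umin uv.
  by apply: filterS => x; rewrite patchE => + Ox; rewrite mem_set.
Qed.

End duality.

End conductivity.

End transfer.

Theorem proposition2p10 (R : realType) (n : nat) (hn : (2 <= n)%N)
  (p q : R) (hp : 1 < p) (hpq : p^-1 + q^-1 = 1)
  (Omega : set 'rV[R]_n) (hOmega : lipschitz_domain Omega)
  (e : 'rV[R]_n) (he : sphere e)
  (w : R -> 'rV[R]_n -> R)
  (hw : forall delta : R, 0 < delta -> nl_kernel p e delta (w delta))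
  (dbar C : R) (hdbar : 0 < dbar) (hC : 0 < C)
  (poincare : forall (delta : R) u, 0 < delta < dbar ->
    U0 p Omega delta (w delta) u ->
    ('N[lebesgue_rV n]_(p%:E)[EFin \o (u \_ Omega)] <=
     C%:E * 'N[lebesgue_rV n \x lebesgue_rV n]_(p%:E)[
       EFin \o (nl_grad Omega (w delta) u \_ (nl_dom Omega delta))])%E)
  (delta : R) (hdelta : 0 < delta < dbar)
  (klo khi : R) (hklo : 0 < klo) (hkhi : klo <= khi)
  (A : set ('rV[R]_n * 'rV[R]_n -> R))
  (hA : conductivities Omega delta klo khi A)
  (kappa : 'rV[R]_n * 'rV[R]_n -> R) (hkappa : A kappa)
  (f : 'rV[R]_n -> R) (hf : Lr (lebesgue_rV n) Omega q%:E f) :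
  let: w := w delta in
  [/\ dual_val p q Omega delta w kappa f =
        ereal_sup [set (- Icheck p Omega delta w kappa f u)%E |
                   u in U0 p Omega delta w],
      forall u, dual_solution p q Omega delta w kappa f u <->
                icheck_solution p Omega delta w kappa f u,
      exists u, [/\ U0 p Omega delta w u,
        dual_solution p q Omega delta w kappa f u &
        forall v, dual_solution p q Omega delta w kappa f v ->
          {ae lebesgue_rV n, forall x, Omega x -> v x = u x}] &
      (icheck p Omega delta w kappa f + ihat p q Omega delta w kappa f = 0)%E].
Proof.
have [_ oOmega _ _ _] := hOmega.
have delta0 : 0 < delta by case/andP: hdelta.
have [mw _ _ _ _] := hw _ delta0.
have [_ ALinf _ _ Abounds] := hA.
have mk : measurable_fun setT (kappa \_ (nl_dom Omega delta)).
  have : (kappa \_ (nl_dom Omega delta)) \in Lfun (lebesgue_rV n \x lebesgue_rV n)%E +oo%E.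
    exact: ALinf.
  by rewrite inE => /andP[/[!inE]].
have kb : {ae (lebesgue_rV n \x lebesgue_rV n)%E, forall z,
    nl_dom Omega delta z -> klo <= kappa z <= khi}.
  by apply: filterS (Abounds _ hkappa) => z h /h[].
have Cp0 : 0 < C `^ p by exact: powR_gt0.
have po := poincare_nlG hp hC (fun u => @poincare delta u hdelta).
have dE := dual_obj_U0 hp hpq oOmega mw hklo hkhi mk kb Cp0 po hf.
have dN := dual_obj_notU0 hp hpq oOmega mw hklo hkhi mk kb Cp0 po hf.
have dvE := dual_valE hp hpq oOmega mw hklo hkhi mk kb Cp0 po hf.
have [u [Uu Iu icE ihE uniq]] := duality hp hpq oOmega mw hklo hkhi mk kb Cp0 po hf.
set W := w delta in Uu Iu icE ihE uniq dE dN dvE *.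
have dvalE : dual_val p q Omega delta W kappa f =
    (- Icheck p Omega delta W kappa f u)%E.
  rewrite dvE; apply/eqP; rewrite eq_le; apply/andP; split.
    apply: ge_ereal_sup => _ [v Uv <-].
    by rewrite leeN2 -icE; apply: ereal_inf_lbound; exists v.
  by apply: ereal_sup_ubound; exists u.
have sol v : dual_solution p q Omega delta W kappa f v <->
    icheck_solution p Omega delta W kappa f v.
  split=> [[vp]|[Uv]].
    rewrite dvalE => dv; have [Uv|Uv] := pselect (U0 p Omega delta W v).
      by split => //; rewrite icE; apply: oppe_inj; rewrite -dv dE.
    (* Outside [U0] the dual objective is -oo, whereas the dual value is finite. *)
    by move: dv; rewrite dN// => h; move: Iu; rewrite -fin_numN -h.
  by rewrite icE => Iv; split; [case: Uv|rewrite dE// dvalE Iv].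
split => //.
- exists u; split => //; first by apply/sol; split.
  by move=> v /sol[Uv Iv]; apply: uniq => //; rewrite Iv.
- by rewrite icE ihE subee.
Qed.
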